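(* Suppose that $f\in C^{1}(\mathbb{H}^n\times\mathbb{R})$ satisfies $f_t(x,t)\le 0$ in $\mathbb{H}^n\times\mathbb{R}$ and the following two conditions: (I) for some fixed $o\in\mathbb{H}^n$ there exists a continuous decreasing function $\phi:[0,+\infty)\to\mathbb{R}$ such that $|f(x,t)|\le\phi(r(x))$ for all $(x,t)\in\mathbb{H}^n\times\mathbb{R}$, where $r(x)=\operatorname{dist}(x,o)$, and $\int_0^{+\infty}\sqrt{\phi(r)}\,dr<\infty$; (II) there is a continuous function $h:\mathbb{R}\to\mathbb{R}$ with $h(t)\to0$ as $t\to\pm\infty$ such that $|f(x,t)|\le h(t)$ for all $x\in\mathbb{H}^n$, $t\in\mathbb{R}$. Let $p_1,\dots,p_k\in\partial_\infty\mathbb{H}^n$ and $\varphi\in C^0(\partial_\infty\mathbb{H}^n)$ be given. If $u\in C^2(\mathbb{H}^n)\cap C^0(\overline{\mathbb{H}^n}\setminus\{p_1,\dots,p_k\})$ is a solution to the Dirichlet problem $$\begin{cases}-\operatorname{div}\dfrac{\nabla v}{\sqrt{1+|\nabla v|^{2}}}=f(x,v)&\text{in }\mathbb{H}^n,\\ v=\varphi&\text{on }\partial_\infty\mathbb{H}^n\setminus\{p_1,\dots,p_k\},\end{cases}$$ then $u\in C^0(\overline{\mathbb{H}^n})$, i.e. $u$ extends continuously to $\overline{\mathbb{H}^n}$.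
   Context: $\mathbb{H}^n$ ($n\ge 2$) is the hyperbolic space of constant sectional curvature $-1$, $\partial_\infty\mathbb{H}^n$ is its asymptotic boundary (sphere at infinity), and $\overline{\mathbb{H}^n}=\mathbb{H}^n\cup\partial_\infty\mathbb{H}^n$ is its geometric compactification with the cone topology. $f_t$ is the partial derivative in the second variable. *)

(* Defs.v *)
From HB Require Import structures.
From mathcomp Require Import all_boot all_order all_algebra.
From mathcomp Require Import all_classical all_reals all_analysis.

Set Implicit Arguments.
Unset Strict Implicit.
Unset Printing Implicit Defensive.

Import Order.TTheory GRing.Theory Num.Theory.
Import numFieldNormedType.Exports.

Local Open Scope classical_set_scope.
Local Open Scope ring_scope.

(* [Ck k A f]: f is of class C^k on the open set A.  It is meant for maps whose
   domain V is finite dimensional; there, continuity of all the iterated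
   directional derivatives is the usual C^k (only the values of f on A
   matter, since A is open). *)
Fixpoint Ck (R : realType) (V W : normedModType R) (k : nat) (A : set V)
    (f : V -> W) : Prop :=
  (forall x, A x -> {for x, continuous f}) /\
  match k with
  | 0%N => True
  | k'.+1 => forall v : V,
      (forall x, A x -> derivable f x v) /\ Ck k' A (fun x => 'D_v f x)
  end.

(* Riemannian geometry of an open subset of R^n, in the standard coordinates:
   a metric is its matrix field g = (g_ij), a tangent vector is the row of its
   components. *)

Definition metric_dot (R : realType) (n : nat) (g : 'rV[R]_n -> 'M[R]_n)
    (x X Y : 'rV[R]_n) : R :=
  (X *m g x *m Y^T) 0 0.

Definition metric_norm (R : realType) (n : nat) (g : 'rV[R]_n -> 'M[R]_n)
    (x X : 'rV[R]_n) : R :=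
  Num.sqrt (metric_dot g x X X).

Definition partial (R : realType) (n : nat) (i : 'I_n) (u : 'rV[R]_n -> R)
    (x : 'rV[R]_n) : R :=
  'D_(delta_mx 0 i) u x.

Definition riem_grad (R : realType) (n : nat) (g : 'rV[R]_n -> 'M[R]_n)
    (u : 'rV[R]_n -> R) (x : 'rV[R]_n) : 'rV[R]_n :=
  (\row_i partial i u x) *m invmx (g x).

Definition riem_vol (R : realType) (n : nat) (g : 'rV[R]_n -> 'M[R]_n)
    (x : 'rV[R]_n) : R :=
  Num.sqrt (\det (g x)).

Definition riem_div (R : realType) (n : nat) (g : 'rV[R]_n -> 'M[R]_n)
    (X : 'rV[R]_n -> 'rV[R]_n) (x : 'rV[R]_n) : R :=
  (riem_vol g x)^-1 *
  \sum_(i < n) partial i (fun y => riem_vol g y * X y 0 i) x.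

Definition curve_length (R : realType) (n : nat) (g : 'rV[R]_n -> 'M[R]_n)
    (c : R -> 'rV[R]_n) : R :=
  \int[lebesgue_measure]_(t in `[0, 1]) metric_norm g (c t) (derive1 c t).

(* Infimum of the lengths of the C^1 curves [0, 1] -> A from x to y; a curve
   that is C^1 on [0, 1] is the restriction of one that is C^1 on R. *)
Definition riem_dist (R : realType) (n : nat) (A : set 'rV[R]_n)
    (g : 'rV[R]_n -> 'M[R]_n) (x y : 'rV[R]_n) : R :=
  inf [set l : R | exists c : R -> 'rV[R]_n,
    [/\ Ck 1 setT c, (forall t, t \in `[0, 1] -> A (c t)),
        c 0 = x, c 1 = y & l = curve_length g c]].

(* Hyperbolic space is the Poincare ball: the Euclidean unit ball with the
   metric g_ij = (2 / (1 - |x|^2))^2 delta_ij.  The geodesic rays issuing from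
   the centre are the Euclidean radii, so the asymptotic boundary is the
   Euclidean unit sphere and the cone topology of the compactification is the
   Euclidean topology of the closed unit ball.  The library norm of 'rV[R]_n is
   the sup norm, whence the explicit Euclidean norm; the topologies agree. *)

Definition eucl_sqnorm (R : realType) (n : nat) (x : 'rV[R]_n) : R :=
  \sum_(i < n) x 0 i ^+ 2.

Definition hyp_space (R : realType) (n : nat) : set 'rV[R]_n :=
  [set x | eucl_sqnorm x < 1].
Arguments hyp_space : clear implicits.

Definition hyp_boundary (R : realType) (n : nat) : set 'rV[R]_n :=
  [set x | eucl_sqnorm x = 1].
Arguments hyp_boundary : clear implicits.

Definition hyp_closure (R : realType) (n : nat) : set 'rV[R]_n :=
  hyp_space R n `|` hyp_boundary R n.
Arguments hyp_closure : clear implicits.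

Definition hyp_metric (R : realType) (n : nat) (x : 'rV[R]_n) : 'M[R]_n :=
  ((2 / (1 - eucl_sqnorm x)) ^+ 2)%:M.

Definition hyp_dist (R : realType) (n : nat) (x y : 'rV[R]_n) : R :=
  riem_dist (hyp_space R n) (@hyp_metric R n) x y.

(* div (grad u / sqrt (1 + |grad u|^2)) in the hyperbolic metric. *)
Definition hyp_mean_curvature (R : realType) (n : nat) (u : 'rV[R]_n -> R)
    (x : 'rV[R]_n) : R :=
  let g := @hyp_metric R n in
  riem_div g
    (fun y => (Num.sqrt (1 + metric_norm g y (riem_grad g u y) ^+ 2))^-1
              *: riem_grad g u y) x.

(* Main.v *)
Require Import Defs.
From HB Require Import structures.
From mathcomp Require Import all_boot all_order all_algebra.
From mathcomp Require Import all_classical all_reals all_analysis.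
From mathcomp Require Import ring lra.
Import Order.TTheory GRing.Theory Num.Theory.
Import numFieldNormedType.Exports.
Local Open Scope classical_set_scope.
Local Open Scope ring_scope.
Set Implicit Arguments.
Unset Strict Implicit.
Unset Printing Implicit Defensive.

(** In the ball model write q = 1 - |x|^2 and let Q u be the mean curvature of the
graph of u.  The solution is a function with |Q u| controlled by its decay at
infinity, so everything reduces to a local statement: near a puncture p, such
a u with boundary values tending to L along the sphere without p has limit L
at p.  Replacing u by -u, only the upper bound limsup u <= L is needed.

_Decay._  A decreasing phi whose square root is integrable satisfies
phi(r) <= C/(1+r)^2 (decr_sqrt_integrable), and the distance to the fixed
point is at least -ln q up to a constant (curve_length_ge,
hyp_dist_lower_bounds).  Hence |Q u| <= K/(1 - ln q)^2
(decay_of_radial_bound).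

_Barriers._  For a vector A and a number a0 with |A|^2 - a0^2 = 1, the function
s(x) = (2 A.x - a0 (1 + |x|^2))/q is the restriction of a linear form to the
hyperboloid; it equals sinh of the signed distance to a totally geodesic
hyperplane, and its hyperbolic Hessian is s times the metric.  So for a
function G of one variable, Q (G o s) is an explicit ordinary differential
expression, and touching_mean_curvature states what it implies where u - G o s
has a maximum.  The comparison principle follows.  Two profiles G are used.
 - One is infinite at s = 2 (scherk), so that no control of u on that
   hypersurface is needed, and is bounded away from it; the cubic term
   (n-1) k^3 s (s^2+1), with k = -G', makes this possible for small Q u and
   n >= 2, and the decay 1/(ln s)^2 is integrable in the variable ln s.
 - The other (hopf) is an exponential with small slope on -3 < s < S; it
   turns a gain of u on the side s >= S - 1 into a definite gain at s >= -2.

_Boundedness at p_ (bounded_above_near_puncture).  Consider half-spaces whose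
complement shrinks to p.  The infinite barrier over their part near p bounds u
by its values away from p, uniformly in the half-space.

_The limsup is at most L_ (limsup_at_puncture).  Suppose that u <= L + c' near p
with c' >= c > 0.  Given x close to p, there is a half-space which lies near p,
contains x up to a bounded hyperbolic distance, and does not have p in its
closure, because its centre is moved off p in the direction of x
(lens_halfspace).  On its boundary at infinity u is about L.  Deep inside it
the infinite barrier gives u <= L + c' - c/2 (deep_lens_bound), and the
exponential barrier, which needs nothing but u <= L + c' on the other side,
propagates a loss w > 0 to x; w depends on c but not on x or c'
(puncture_improvement).  So the infimum of the admissible c' cannot be
positive. *)

(** * Derivatives of functions of one variable *)

Definition der (R : realType) (f : R -> R) (t d : R) : Prop := is_derive t 1 f d.

Lemma der_eq (R : realType) (f : R -> R) (t a b : R) :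
  der f t a -> a = b -> der f t b.
Proof. by move=> ? <-. Qed.

Lemma der_cst (R : realType) (c t : R) : der (fun _ : R => c) t 0.
Proof. exact: is_derive_cst. Qed.

Lemma der_id (R : realType) (t : R) : der (fun s : R => s) t 1.
Proof. exact: is_derive_id. Qed.

Lemma der_add (R : realType) (f g : R -> R) (t a b : R) :
  der f t a -> der g t b -> der (fun s : R => f s + g s) t (a + b).
Proof. by move=> fa gb; exact: is_deriveD. Qed.

Lemma der_opp (R : realType) (f : R -> R) (t a : R) :
  der f t a -> der (fun s : R => - f s) t (- a).
Proof. by move=> fa; exact: is_deriveN. Qed.

Lemma der_sub (R : realType) (f g : R -> R) (t a b : R) :
  der f t a -> der g t b -> der (fun s : R => f s - g s) t (a - b).
Proof. by move=> fa gb; exact: is_deriveB. Qed.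

Lemma der_mul (R : realType) (f g : R -> R) (t a b : R) :
  der f t a -> der g t b ->
  der (fun s : R => f s * g s) t (f t * b + a * g t).
Proof. by move=> fa gb; apply: (der_eq (is_deriveM fa gb)); rewrite [a * _]mulrC. Qed.

Lemma der_scale (R : realType) (f : R -> R) (c t a : R) :
  der f t a -> der (fun s : R => c * f s) t (c * a).
Proof. by move=> fa; apply: (der_eq (der_mul (der_cst c t) fa)); rewrite mul0r addr0. Qed.

Lemma der_inv (R : realType) (f : R -> R) (t a : R) : f t != 0 ->
  der f t a -> der (fun s : R => (f s)^-1) t (- (a / f t ^+ 2)).
Proof.
by move=> f0 fa; apply: (der_eq (is_deriveV f0 fa)); rewrite [_ *: _]mulrC mulrN.
Qed.

Lemma der_exp (R : realType) (f : R -> R) (m : nat) (t a : R) :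
  der f t a -> der (fun s : R => f s ^+ m) t (m%:R * f t ^+ m.-1 * a).
Proof.
move=> fa; have -> : (fun s : R => f s ^+ m) = f ^+ m.
  by apply/funext => s; elim: m => [|m IH]; rewrite ?expr0 // !exprS IH.
exact: is_deriveX.
Qed.

Lemma der_comp (R : realType) (f g : R -> R) (t a b : R) :
  der f (g t) a -> der g t b -> der (fun s : R => f (g s)) t (a * b).
Proof. by move=> fa gb; exact: is_derive1_comp. Qed.

Lemma der_sqrt (R : realType) (f : R -> R) (t a : R) : 0 < f t ->
  der f t a -> der (fun s : R => Num.sqrt (f s)) t (a / (2 * Num.sqrt (f t))).
Proof.
move=> f0 fa; apply: (der_eq (der_comp (is_derive1_sqrt f0) fa)); exact: mulrC.
Qed.

Lemma der_sum (R : realType) (n : nat) (f : 'I_n -> R -> R) (t : R) (a : 'I_n -> R) :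
  (forall i, der (f i) t (a i)) ->
  der (fun s : R => \sum_i f i s) t (\sum_i a i).
Proof.
move=> fa; have -> : (fun s : R => \sum_i f i s) = \sum_i f i.
  by apply/funext => s; rewrite fct_sumE.
exact: is_derive_sum.
Qed.

(** * Directional derivatives and restriction to lines *)

(** Fixing the codomain to be the field of scalars lets the values be used
    directly in ring expressions. *)
Definition dir_deriv (R : realType) (V : normedModType R) (v : V) (f : V -> R) (x : V) : R := 'D_v f x.

(** Every statement about directional derivatives is transported to one
    variable through this lemma. *)
Lemma der_line (R : realType) (n : nat) (f : 'rV[R]_n -> R) (x v : 'rV[R]_n) (t : R) :
  derivable f (t *: v + x) v ->
  der (fun s : R => f (s *: v + x)) t (dir_deriv v f (t *: v + x)).
Proof.
move=> df.
have E : (fun h : R => h^-1 *: (((fun s : R => f (s *: v + x)) \o shift t) (h *: 1) - f (t *: v + x)))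
   = (fun h : R => h^-1 *: ((f \o shift (t *: v + x)) (h *: v) - f (t *: v + x))).
  apply/funext => h /=; rewrite /shift /=; congr (_ *: (f _ - _)).
  by rewrite scaler1 scalerDl addrA.
split.
  by rewrite /derivable E.
by rewrite /dir_deriv /derive E.
Qed.

Lemma derive_quotient (R : realType) (V : normedModType R) (f : V -> R) (x v : V) (e : R) :
  derivable f x v -> 0 < e -> exists2 d : R, 0 < d &
  forall h : R, h != 0 -> `|h| < d -> `|(f (h *: v + x) - f x) / h - dir_deriv v f x| <= e.
Proof.
move=> df e0.
have : (fun h : R => h^-1 *: ((f \o shift x) (h *: v) - f x)) @ 0^' --> 'D_v f x by exact: df.
move=> /cvgrPdist_le /(_ _ e0) /nbhs_ballP[d /= d0 Hd].
exists d => // h h0 hd.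
have /= := Hd h; rewrite /ball /= sub0r normrN => /(_ hd h0).
by rewrite distrC [_ *: _]mulrC.
Qed.

Lemma continuous_at_dist (R : realType) (V : normedModType R) (f : V -> R) (x : V) (e : R) :
  {for x, continuous f} -> 0 < e -> exists2 d : R, 0 < d &
  forall y, `|y - x| < d -> `|f y - f x| <= e.
Proof.
move=> /cvgrPdist_le cf /cf /nbhs_ballP[d /= d0 Hd].
exists d => // y yd; rewrite distrC; apply: Hd.
by rewrite -ball_normE /= distrC.
Qed.

Lemma open_dist (R : realType) (V : normedModType R) (A : set V) (x : V) :
  open A -> A x -> exists2 d : R, 0 < d & forall y, `|y - x| < d -> A y.
Proof.
move=> oA Ax; have /nbhs_ballP[d /= d0 Hd] : nbhs x A by exact: open_nbhs_nbhs.
exists d => // y yd; apply: Hd.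
by rewrite -ball_normE /= distrC.
Qed.

(** Additivity in the direction does not come from existence of the
    directional derivatives alone: it uses the continuity of one of them.
    The increment along v + w is cut into an increment along w and one along
    v; the mean value theorem writes the second as a derivative at a nearby
    point. *)
Lemma deriveD_Ck1 (R : realType) (n : nat) (A : set 'rV[R]_n) (f : 'rV[R]_n -> R)
    (x v w : 'rV[R]_n) :
  open A -> Ck 1 A f -> A x ->
  dir_deriv (v + w) f x = dir_deriv v f x + dir_deriv w f x.
Proof.
move=> oA [_ C1] Ax.
have dv y : A y -> derivable f y v by move=> Ay; exact: (C1 v).1.
have [cv _] := (C1 v).2.
suff H (e : R) : 0 < e -> `|dir_deriv (v + w) f x - (dir_deriv v f x + dir_deriv w f x)| <= e.
  apply/eqP; rewrite -subr_eq0 -normr_eq0 eq_le normr_ge0 andbT.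
  by apply/ler_addgt0Pl => z z0; rewrite addr0; exact: H.
move=> e0; have e4 : 0 < e / 4 by rewrite divr_gt0.
have [d1 d10 H1] := derive_quotient ((C1 (v + w)).1 x Ax) e4.
have [d2 d20 H2] := derive_quotient ((C1 w).1 x Ax) e4.
have [d3 d30 H3] := continuous_at_dist (cv _ Ax) e4.
have [d4 d40 H4] := open_dist oA Ax.
(* The step h is small enough for the quotients along v + w and w,
   and for the whole segment from h w to h (v + w) to stay where D_v
   f is close to its value at x. *)
pose N : R := `|v| + `|w| + 1.
have N0 : 0 < N by rewrite ltr_wpDl // addr_ge0.
pose m : R := Num.min (Num.min d1 d2) (Num.min d3 d4).
have m0 : 0 < m by rewrite /m !lt_min d10 d20 d30 d40.
pose h : R := Num.min (m / 2) (m / (2 * N)).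
have h0 : 0 < h by rewrite /h lt_min !divr_gt0 // mulr_gt0.
have hm : h < m.
  rewrite (@le_lt_trans _ _ (m / 2)) // ?ge_min ?lexx //.
  by rewrite ltr_pdivrMr // mulr_natr mulr2n ltrDl.
have hNm : h * N < m.
  apply: (@le_lt_trans _ _ (m / (2 * N) * N)).
    by rewrite ler_pM2r // ge_min lexx orbT.
  rewrite invfM mulrA divfK ?gt_eqF //.
  by rewrite ltr_pdivrMr // mulr_natr mulr2n ltrDl.
have close (t : R) : 0 <= t -> t <= h -> `|t *: v + (h *: w + x) - x| < m.
  move=> t0 th; apply: le_lt_trans hNm.
  rewrite addrA addrK (le_trans (ler_normD _ _)) // !normrZ (ger0_norm t0) (gtr0_norm h0).
  rewrite /N !mulrDr mulr1 -addrA lerD // ?ler_wpM2r //.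
  by rewrite lerDl ltW.
have [m1 m2] : m <= d1 /\ m <= d2 by rewrite /m !ge_min !lexx ?orbT.
have [m3 m4] : m <= d3 /\ m <= d4 by rewrite /m !ge_min !lexx ?orbT.
have [c c_in Hc] : exists2 c : R, c \in `]0, h[ &
    f (h *: v + (h *: w + x)) - f (0 *: v + (h *: w + x)) =
      dir_deriv v f (c *: v + (h *: w + x)) * (h - 0).
  have dl (t : R) : 0 <= t -> t <= h ->
      is_derive t 1 (fun s : R => f (s *: v + (h *: w + x)))
        (dir_deriv v f (t *: v + (h *: w + x))).
    move=> t0 th; apply/der_line/dv/H4.
    exact: (lt_le_trans (close _ t0 th)).
  apply: (@MVT _ (fun s : R => f (s *: v + (h *: w + x)))
    (fun s : R => dir_deriv v f (s *: v + (h *: w + x)))) => //.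
    by move=> t; rewrite in_itv /= => /andP[t0 th]; apply: dl; exact: ltW.
  apply: derivable_within_continuous => t; rewrite in_itv /= => /andP[t0 th].
  by case: (dl t t0 th).
move: c_in; rewrite in_itv /= => /andP[c0 ch].
have hn0 : h != 0 by rewrite gt_eqF.
have nh : `|h| < m by rewrite gtr0_norm.
have A1 := H1 h hn0 (lt_le_trans nh m1).
have A2 := H2 h hn0 (lt_le_trans nh m2).
have A3 : `|dir_deriv v f (c *: v + (h *: w + x)) - dir_deriv v f x| <= e / 4.
  by apply: H3; apply: (lt_le_trans (close _ (ltW c0) (ltW ch))).
have E1 : (f (h *: (v + w) + x) - f x) / h =
    dir_deriv v f (c *: v + (h *: w + x)) + (f (h *: w + x) - f x) / h.
  rewrite subr0 scale0r add0r in Hc.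
  have -> : dir_deriv v f (c *: v + (h *: w + x)) =
      (f (h *: v + (h *: w + x)) - f (h *: w + x)) / h by rewrite Hc mulfK.
  rewrite -mulrDl; congr (_ / _).
  by rewrite addrA subrK scalerDr addrA.
rewrite E1 in A1.
move: A1 A2 A3; rewrite !ler_norml; set X := dir_deriv v f (c *: _ + _); set Y := (_ / h).
move=> /andP[a1 a2] /andP[b1 b2] /andP[c1 c2].
by clear - a1 a2 b1 b2 c1 c2; apply/andP; split; lra.
Qed.

(** Rescaling the parameter of a line, as a chain rule in one variable. *)
Lemma deriveZ_dir (R : realType) (n : nat) (f : 'rV[R]_n -> R) (x v : 'rV[R]_n) (c : R) :
  derivable f x v -> dir_deriv (c *: v) f x = c * dir_deriv v f x.
Proof.
move=> df; have [->|c0] := eqVneq c 0; first by rewrite scale0r /dir_deriv derive0 mul0r.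
have H0 : is_derive (0:R) 1 (fun s : R => f (s *: v + x)) (dir_deriv v f x).
  by have := @der_line R n f x v 0; rewrite scale0r add0r; apply.
have -> : dir_deriv (c *: v) f x = 'D_1 ((fun s : R => f (s *: v + x)) \o ( *%R c)) 0.
  have E : (fun h : R => h^-1 *: ((f \o shift x) (h *: (c *: v)) - f x)) =
      (fun h : R => h^-1 *: ((((fun s : R => f (s *: v + x)) \o ( *%R c)) \o shift (0 : R)) (h *: (1 : R))
        - ((fun s : R => f (s *: v + x)) \o ( *%R c)) 0)).
    apply/funext => h /=.
    by rewrite mulr0 scale0r add0r addr0 [h *: 1]mulr1 scalerA mulrC.
  by rewrite /dir_deriv /derive E.
have dl : is_derive (0:R) 1 ( *%R c) c.
  by apply: (der_eq (der_scale c (der_id 0))); rewrite mulr1.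
rewrite -derive1E derive1_comp /= ?mulr0 ?derive1E; last 2 first.
- by case: dl.
- by case: H0.
by rewrite (derive_val (is_derive := H0)) (derive_val (is_derive := dl)) mulrC.
Qed.

(** If the second derivative were positive, the first one, which vanishes at
    0, would be positive just after 0 and the function would exceed its
    maximum. *)
Lemma second_derivative_at_max (R : realType) (a da : R -> R) (dda d : R) :
  0 < d -> (forall t : R, `|t| < d -> der a t (da t)) ->
  der da 0 dda -> (forall t : R, `|t| < d -> a t <= a 0) ->
  da 0 = 0 /\ dda <= 0.
Proof.
move=> d0 Ha Hda amax.
have da0 : da 0 = 0.
  have : is_derive (0:R) 1 a 0.
    apply: (@derive1_at_max _ a (- d) d) => [|t|| t].
    - by rewrite ge0_cp // ltW.
    - by rewrite in_itv /= -ltr_norml => /Ha[].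
    - by rewrite in_itv /= oppr_lt0 d0.
    - by rewrite in_itv /= -ltr_norml => /amax.
  have [_ <-] := Ha 0 ltac:(by rewrite normr0).
  by move=> [].
split=> //; rewrite leNgt; apply/negP => dda0.
have dd2 : 0 < dda / 2 by rewrite divr_gt0.
have [e e0 He] := @derive_quotient _ _ da 0 1 _ (ex_derive (is_derive := Hda)) dd2.
have D0 : dir_deriv (1 : R) da (0 : R) = dda by case: Hda.
rewrite D0 in He.
have pos (h : R) : 0 < h -> h < e -> 0 < da h.
  move=> h0 he; have /= := He h; rewrite gt_eqF // gtr0_norm // addr0 da0 subr0 => /(_ isT he).
  rewrite [h *: _]mulr1 ler_norml => /andP[+ _].
  move=> H; rewrite -(divfK (lt0r_neq0 h0) (da h)) mulr_gt0 //.
  by move: H dd2; set q := da h / h => H dd2; lra.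
pose h : R := Num.min d e / 2.
have m0 : 0 < Num.min d e by rewrite lt_min d0.
have h0 : 0 < h by rewrite divr_gt0.
have hm : h < Num.min d e by rewrite /h; lra.
have hd : h < d by rewrite (lt_le_trans hm) // ge_min lexx.
have he : h < e by rewrite (lt_le_trans hm) // ge_min lexx orbT.
have Hd (t : R) : 0 <= t -> t <= h -> `|t| < d.
  by move=> t0 th; rewrite ger0_norm // (le_lt_trans th).
have [c] : exists2 c, c \in `]0, h[ & a h - a 0 = da c * (h - 0).
  apply: MVT => // [t|].
    by rewrite in_itv /= => /andP[t0 th]; apply: Ha; apply: Hd; exact: ltW.
  apply: derivable_within_continuous => t; rewrite in_itv /= => /andP[t0 th].
  by case: (Ha t (Hd _ t0 th)).
rewrite in_itv /= subr0 => /andP[c0 ch] E.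
have := amax h (Hd _ (ltW h0) (lexx _)).
by rewrite -subr_le0 E leNgt mulr_gt0 // pos // (lt_trans ch).
Qed.

(** * Euclidean scalar product *)

Definition dot (R : realType) (n : nat) (x y : 'rV[R]_n) : R := \sum_i x 0 i * y 0 i.

Lemma dotC (R : realType) (n : nat) (x y : 'rV[R]_n) : dot x y = dot y x.
Proof. by apply: eq_bigr => i _; rewrite mulrC. Qed.

Lemma dotDr (R : realType) (n : nat) (x y z : 'rV[R]_n) : dot x (y + z) = dot x y + dot x z.
Proof. by rewrite -big_split; apply: eq_bigr => i _; rewrite !mxE mulrDr. Qed.

Lemma dotZr (R : realType) (n : nat) (c : R) (x y : 'rV[R]_n) : dot x (c *: y) = c * dot x y.
Proof. by rewrite mulr_sumr; apply: eq_bigr => i _; rewrite !mxE mulrCA. Qed.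

Lemma dotDl (R : realType) (n : nat) (x y z : 'rV[R]_n) : dot (x + y) z = dot x z + dot y z.
Proof. by rewrite ![dot _ z]dotC dotDr. Qed.

Lemma dotZl (R : realType) (n : nat) (c : R) (x y : 'rV[R]_n) : dot (c *: x) y = c * dot x y.
Proof. by rewrite dotC dotZr dotC. Qed.

Lemma dotNr (R : realType) (n : nat) (x y : 'rV[R]_n) : dot x (- y) = - dot x y.
Proof. by rewrite -scaleN1r dotZr mulN1r. Qed.

Lemma dotNl (R : realType) (n : nat) (x y : 'rV[R]_n) : dot (- x) y = - dot x y.
Proof. by rewrite dotC dotNr dotC. Qed.

Definition dotE := (dotDr, dotDl, dotZr, dotZl, dotNr, dotNl).

Lemma sqnE (R : realType) (n : nat) (x : 'rV[R]_n) : eucl_sqnorm x = dot x x.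
Proof. by apply: eq_bigr => i _; rewrite expr2. Qed.

Lemma sqn_ge0 (R : realType) (n : nat) (x : 'rV[R]_n) : 0 <= eucl_sqnorm x.
Proof. by apply: sumr_ge0 => i _; exact: sqr_ge0. Qed.

Lemma sqn0 (R : realType) (n : nat) : eucl_sqnorm (0 : 'rV[R]_n) = 0.
Proof. by rewrite /eucl_sqnorm big1 // => i _; rewrite mxE expr0n. Qed.

Lemma sqn_line (R : realType) (n : nat) (t : R) (v x : 'rV[R]_n) :
  eucl_sqnorm (t *: v + x) = eucl_sqnorm x + 2 * dot x v * t + eucl_sqnorm v * t ^+ 2.
Proof. by rewrite !sqnE !dotE [dot v x]dotC; ring. Qed.

Lemma dot_delta (R : realType) (n : nat) (x : 'rV[R]_n) (i : 'I_n) :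
  dot x (delta_mx 0 i) = x 0 i.
Proof.
rewrite /dot (bigD1 i) //= big1 ?mxE ?eqxx ?mulr1 ?addr0 // => j ji.
by rewrite mxE eqxx (negbTE ji) mulr0.
Qed.

Lemma continuous_sumr (R : realType) (T : topologicalType) (I : Type) (s : seq I)
    (F : I -> T -> R) :
  (forall i, continuous (F i)) -> continuous (fun y => \sum_(i <- s) F i y).
Proof.
move=> cF x; elim: s => [|i s IH].
  have -> : (fun y : T => \sum_(i <- [::]) F i y) = fun=> 0.
    by apply/funext => y; rewrite big_nil.
  exact: cvg_cst.
have -> : (fun y : T => \sum_(j <- i :: s) F j y) = (fun y => F i y + \sum_(j <- s) F j y).
  by apply/funext => y; rewrite big_cons.
by apply: cvgD; [exact: cF|exact: IH].
Qed.

Lemma dot_continuous (R : realType) (n : nat) (a : 'rV[R]_n) : continuous (dot a).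
Proof.
apply: continuous_sumr => i x.
apply: (@continuous_comp _ _ _ (fun y : 'rV[R]_n => y 0 i) (fun r : R => a 0 i * r)).
  exact: coord_continuous.
exact: mulrl_continuous.
Qed.

Lemma sqn_continuous (R : realType) (n : nat) : continuous (@eucl_sqnorm R n).
Proof.
apply: continuous_sumr => i x.
apply: (@continuous_comp _ _ _ (fun y : 'rV[R]_n => y 0 i) (fun r : R => r ^+ 2)).
  exact: coord_continuous.
exact: exprn_continuous.
Qed.

Lemma hyp_space_open (R : realType) (n : nat) : open (hyp_space R n).
Proof.
have -> : hyp_space R n = @eucl_sqnorm R n @^-1` [set r | r < 1] by [].
apply: open_comp; last exact: open_lt.
by move=> x _; exact: sqn_continuous.
Qed.

(** * The hyperbolic mean curvature operator in the ball coordinates *)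

Definition eucl_grad (R : realType) (n : nat) (u : 'rV[R]_n -> R) (x : 'rV[R]_n) : 'rV[R]_n :=
  \row_i dir_deriv (delta_mx 0 i) u x.

(** The metric is conformal to the Euclidean one, so the volume density is
    l^(-n) and the squared norm of the gradient is l^2 |grad u|^2, where l
    is the inverse of the conformal factor. *)
Lemma mean_curvature_integrand (R : realType) (n : nat) (u : 'rV[R]_n -> R) (y : 'rV[R]_n) (i : 'I_n) :
  let l := (1 - eucl_sqnorm y) / 2 in
  let g := @hyp_metric R n in
  0 < l ->
  riem_vol g y * ((Num.sqrt (1 + metric_norm g y (riem_grad g u y) ^+ 2))^-1
              *: riem_grad g u y) 0 i =
  l^-1 ^+ n * ((Num.sqrt (1 + l ^+ 2 * eucl_sqnorm (eucl_grad u y)))^-1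
     * (l ^+ 2 * dir_deriv (delta_mx 0 i) u y)).
Proof.
move=> l g l0.
have gE : g y = (l^-1 ^+ 2)%:M by rewrite /g /hyp_metric /l invf_div.
have vE : riem_vol g y = l^-1 ^+ n.
  rewrite /riem_vol gE det_scalar -exprM mulnC exprM sqrtr_sqr ger0_norm //.
  by rewrite exprn_ge0 // invr_ge0 ltW.
have grE : riem_grad g u y = l ^+ 2 *: eucl_grad u y.
  rewrite /riem_grad gE invmx_scalar exprVn invrK mul_mx_scalar.
  by congr (_ *: _).
have nE : metric_norm g y (riem_grad g u y) ^+ 2 = l ^+ 2 * eucl_sqnorm (eucl_grad u y).
  have E : metric_dot g y (riem_grad g u y) (riem_grad g u y) =
      l ^+ 2 * eucl_sqnorm (eucl_grad u y).
    rewrite /metric_dot gE grE mul_mx_scalar scalerA -scalemxAl mxE mxE.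
    have -> : \sum_j eucl_grad u y 0 j * (l ^+ 2 *: eucl_grad u y)^T j 0 =
       l ^+ 2 * eucl_sqnorm (eucl_grad u y).
      by rewrite /eucl_sqnorm mulr_sumr; apply: eq_bigr => j _; rewrite !mxE; ring.
    by rewrite exprVn mulVf ?mul1r // expf_neq0 // gt_eqF.
  by rewrite /metric_norm E sqr_sqrtr // mulr_ge0 ?sqr_ge0 // sqn_ge0.
by rewrite nE vE grE !mxE.
Qed.

(** Logarithmic form: it avoids the predecessor of the exponent when the
    exponent is a variable. *)
Lemma der_exp_log (R : realType) (f : R -> R) (m : nat) (t a : R) : f t != 0 ->
  der f t a -> der (fun s : R => f s ^+ m) t (m%:R * f t ^+ m * (a / f t)).
Proof.
move=> f0 fa; apply: (der_eq (der_exp m fa)); case: m => [|m /=]; first by rewrite !mul0r.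
by rewrite exprS; field.
Qed.

(** The contribution of the i-th partial derivative to the divergence, after
    the volume density has cancelled; p stands for the Euclidean gradient of
    u and H for its matrix of second derivatives. *)
Definition mc_term (R : realType) (n : nat) (p : 'rV[R]_n) (H : 'I_n -> 'I_n -> R) (x : 'rV[R]_n)
    (i : 'I_n) : R :=
  let l := (1 - eucl_sqnorm x) / 2 in
  let W := Num.sqrt (1 + l ^+ 2 * eucl_sqnorm p) in
  (n%:R - 2) * l * x 0 i * p 0 i / W + l ^+ 2 * H i i / W
    - l ^+ 2 * p 0 i / W ^+ 3 * (l ^+ 2 * (\sum_j p 0 j * H i j) - l * x 0 i * eucl_sqnorm p).

Lemma mean_curvature_expand (R : realType) (n : nat) (u : 'rV[R]_n -> R) (x : 'rV[R]_n) :
  Ck 2 (hyp_space R n) u -> hyp_space R n x ->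
  hyp_mean_curvature u x =
  \sum_i mc_term (eucl_grad u x)
    (fun i j => dir_deriv (delta_mx 0 i) (dir_deriv (delta_mx 0 j) u) x) x i.
Proof.
move=> uC2 hx.
pose l (y : 'rV[R]_n) : R := (1 - eucl_sqnorm y) / 2.
have l0 y : hyp_space R n y -> 0 < l y.
  by rewrite /hyp_space /l /= => hy; rewrite divr_gt0 // subr_gt0.
have lx := l0 _ hx.
rewrite /hyp_mean_curvature /riem_div.
have -> : riem_vol (@hyp_metric R n) x = (l x)^-1 ^+ n.
  rewrite /riem_vol /hyp_metric det_scalar -exprM mulnC exprM sqrtr_sqr ger0_norm.
    by rewrite /l invf_div.
  by rewrite exprn_ge0 // -invf_div invr_ge0 ltW.
rewrite -exprVn invrK mulr_sumr; apply: eq_bigr => i _.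
set e : 'rV[R]_n := delta_mx 0 i.
pose H (i j : 'I_n) : R := dir_deriv (delta_mx 0 i) (dir_deriv (delta_mx 0 j) u) x.
rewrite -/H.
set p := eucl_grad u x.
pose L (t : R) : R := l (t *: e + x).
have L0 : L 0 = l x by rewrite /L scale0r add0r.
have dL : der L 0 (- x 0 i).
  have -> : L = (fun t => (1 - (eucl_sqnorm x + 2 * dot x e * t + eucl_sqnorm e * t ^+ 2)) * 2^-1).
    by apply/funext => t; rewrite /L /l sqn_line.
  apply: der_eq.
    apply: der_mul; last exact: der_cst.
    apply: der_sub; first exact: der_cst.
    apply: der_add; last by apply: der_scale; apply: der_exp; apply: der_id.
    by apply: der_add; [exact: der_cst|apply: der_scale; exact: der_id].
  by rewrite /e dot_delta /=; field.
pose P (j : 'I_n) (t : R) : R := dir_deriv (delta_mx 0 j) u (t *: e + x).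
have P0 j : P j 0 = p 0 j by rewrite /P scale0r add0r mxE.
have dP j : der (P j) 0 (H i j).
  have := @der_line R n (dir_deriv (delta_mx 0 j) u) x e 0.
  rewrite scale0r add0r; apply.
  have [_ /(_ (delta_mx 0 j)) [_ [_ /(_ e) [+ _]]]] := uC2.
  exact.
pose W (t : R) : R := Num.sqrt (1 + L t ^+ 2 * \sum_j P j t ^+ 2).
pose F (t : R) : R := (L t)^-1 ^+ n * ((W t)^-1 * (L t ^+ 2 * P i t)).
have [d d0 Hd] := open_dist (@hyp_space_open R n) hx.
have eF : partial i (fun y => riem_vol (@hyp_metric R n) y *
    ((Num.sqrt (1 + metric_norm (@hyp_metric R n) y (riem_grad (@hyp_metric R n) u y) ^+ 2))^-1
              *: riem_grad (@hyp_metric R n) u y) 0 i) x = 'D_1 F 0.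
  have E : {near x, (fun y => riem_vol (@hyp_metric R n) y *
    ((Num.sqrt (1 + metric_norm (@hyp_metric R n) y (riem_grad (@hyp_metric R n) u y) ^+ 2))^-1
              *: riem_grad (@hyp_metric R n) u y) 0 i) =1 (fun y =>
     (l y)^-1 ^+ n * ((Num.sqrt (1 + l y ^+ 2 * eucl_sqnorm (eucl_grad u y)))^-1
     * (l y ^+ 2 * dir_deriv (delta_mx 0 i) u y)))}.
    apply/nbhs_ballP; exists d => // y; rewrite -ball_normE /= distrC => /Hd hy.
    by apply: mean_curvature_integrand; exact: l0.
  rewrite /partial (near_eq_derive _ E).
  have E2 (h : R) : (l (h *: e + x))^-1 ^+ n * ((Num.sqrt (1 + l (h *: e + x) ^+ 2 * eucl_sqnorm (eucl_grad u (h *: e + x))))^-1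
     * (l (h *: e + x) ^+ 2 * dir_deriv (delta_mx 0 i) u (h *: e + x))) = F h.
    rewrite /F /W /P /L /eucl_sqnorm; do 6 f_equal.
    by apply: eq_bigr => j _; rewrite mxE.
  have E3 : (fun h : R => h^-1 *: (((fun y =>
     (l y)^-1 ^+ n * ((Num.sqrt (1 + l y ^+ 2 * eucl_sqnorm (eucl_grad u y)))^-1
     * (l y ^+ 2 * dir_deriv (delta_mx 0 i) u y))) \o shift x) (h *: e) - ((fun y =>
     (l y)^-1 ^+ n * ((Num.sqrt (1 + l y ^+ 2 * eucl_sqnorm (eucl_grad u y)))^-1
     * (l y ^+ 2 * dir_deriv (delta_mx 0 i) u y))) x)))
     = (fun h : R => h^-1 *: ((F \o shift (0 : R)) (h *: (1 : R)) - F 0)).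
    have E0 := E2 0; rewrite scale0r add0r in E0.
    apply/funext => h /=; rewrite E2 E0 addr0.
    by rewrite [h *: 1]mulr1.
  by rewrite /derive E3.
rewrite {}eF.
have SP : \sum_j P j 0 ^+ 2 = eucl_sqnorm p by apply: eq_bigr => j _; rewrite P0.
have W20 : 0 < 1 + L 0 ^+ 2 * \sum_j P j 0 ^+ 2.
  by rewrite ltr_wpDr // SP mulr_ge0 ?sqr_ge0 // sqn_ge0.
have W0 : 0 < W 0 by rewrite sqrtr_gt0.
have dW : der W 0
   ((L 0 ^+ 2 * (\sum_j p 0 j * H i j) - L 0 * x 0 i * eucl_sqnorm p) / W 0).
  apply: der_eq.
    apply: der_sqrt; first exact: W20.
    apply: der_add; first exact: der_cst.
    apply: der_mul; first by apply: der_exp; exact: dL.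
    by apply: der_sum => j; apply: der_exp; exact: dP.
  rewrite /= -/(W 0) SP.
  have -> : \sum_i0 2 * P i0 0 ^+ 1 * H i i0 = 2 * \sum_j p 0 j * H i j.
    by rewrite mulr_sumr; apply: eq_bigr => j _; rewrite P0; ring.
  by field; rewrite gt_eqF.
have LN : L 0 != 0 by rewrite L0 gt_eqF.
have dF : der F 0 (L 0 ^- n * mc_term p H x i).
  apply: der_eq.
    apply: der_mul.
      apply: der_exp_log; last by apply: der_inv; [|exact: dL]; rewrite L0 gt_eqF.
      by rewrite invr_eq0.
    apply: der_mul; first by apply: der_inv; [|exact: dW]; rewrite gt_eqF.
    apply: der_mul; last exact: dP.
    by apply: der_exp; exact: dL.
  rewrite /= !P0 /mc_term -/(l x) -L0 expr1.
  have -> : Num.sqrt (1 + L 0 ^+ 2 * eucl_sqnorm p) = W 0 by rewrite /W SP.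
  rewrite exprVn; set Z := L 0 ^- n.
  by move: (gt_eqF W0) => /negbT Wn; field; rewrite LN Wn.
rewrite (@derive_val _ _ _ _ _ _ _ dF) -L0 mulrA mulfV ?mul1r // expf_neq0 //.
Qed.

(** * Signed distance to totally geodesic hyperplanes *)

(** On the hyperboloid the point x of the ball is (1+|x|^2, 2x)/(1-|x|^2);
    this is the restriction of a linear form. When |A|^2 - a0^2 = 1 it is
    sinh of the signed distance to a totally geodesic hyperplane. *)
Definition geo (R : realType) (n : nat) (A : 'rV[R]_n) (a0 : R) (x : 'rV[R]_n) : R :=
  (2 * dot A x - a0 * (1 + eucl_sqnorm x)) / (1 - eucl_sqnorm x).

Definition geo_d (R : realType) (n : nat) (A : 'rV[R]_n) (a0 : R) (v x : 'rV[R]_n) : R :=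
  2 / (1 - eucl_sqnorm x) * (dot A v + (geo A a0 x - a0) * dot x v).

(** Only the second derivative in a repeated direction is ever used; the
    factor 2/(1-|x|^2) is differentiated as well, whence the term in geo_d. *)
Definition geo_dd (R : realType) (n : nat) (A : 'rV[R]_n) (a0 : R) (v x : 'rV[R]_n) : R :=
  2 / (1 - eucl_sqnorm x) *
    (2 * geo_d A a0 v x * dot x v + (geo A a0 x - a0) * eucl_sqnorm v).

Lemma hyp_spaceN0 (R : realType) (n : nat) (x : 'rV[R]_n) :
  hyp_space R n x -> 1 - eucl_sqnorm x != 0.
Proof. by rewrite /hyp_space /= => hx; rewrite gt_eqF // subr_gt0. Qed.

Lemma der_sqn_line (R : realType) (n : nat) (v x : 'rV[R]_n) (t : R) :
  der (fun t => eucl_sqnorm (t *: v + x)) t (2 * dot (t *: v + x) v).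
Proof.
have -> : (fun t => eucl_sqnorm (t *: v + x)) =
    (fun t => (eucl_sqnorm x + 2 * dot x v * t) + eucl_sqnorm v * t ^+ 2).
  by apply/funext => s; rewrite sqn_line.
apply: der_eq.
  apply: der_add; last by apply: der_scale; apply: der_exp; exact: der_id.
  by apply: der_add; [exact: der_cst|apply: der_scale; exact: der_id].
by rewrite /= sqnE !dotE; ring.
Qed.

Lemma der_dot_line (R : realType) (n : nat) (a v x : 'rV[R]_n) (t : R) :
  der (fun t => dot a (t *: v + x)) t (dot a v).
Proof.
have -> : (fun t => dot a (t *: v + x)) = (fun t => dot a x + dot a v * t).
  by apply/funext => s; rewrite !dotE; ring.
apply: der_eq.
  by apply: der_add; [exact: der_cst|apply: der_scale; exact: der_id].
by ring.
Qed.

Lemma der_geo (R : realType) (n : nat) (A : 'rV[R]_n) (a0 : R) (v x : 'rV[R]_n) (t : R) :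
  hyp_space R n (t *: v + x) ->
  der (fun t => geo A a0 (t *: v + x)) t (geo_d A a0 v (t *: v + x)).
Proof.
move=> /hyp_spaceN0 q0; apply: der_eq.
  apply: der_mul; last first.
    by apply: der_inv => //; apply: der_sub; [exact: der_cst|exact: der_sqn_line].
  apply: der_sub; first by apply: der_scale; exact: der_dot_line.
  by apply: der_scale; apply: der_add; [exact: der_cst|exact: der_sqn_line].
by rewrite /geo_d /geo; field.
Qed.

Lemma der_geo_d (R : realType) (n : nat) (A : 'rV[R]_n) (a0 : R) (v x : 'rV[R]_n) :
  hyp_space R n x ->
  der (fun t => geo_d A a0 v (t *: v + x)) 0 (geo_dd A a0 v x).
Proof.
move=> hx; have q0 := hyp_spaceN0 hx.
have E0 : 0 *: v + x = x by rewrite scale0r add0r.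
apply: der_eq.
  apply: der_mul.
    by apply: der_scale; apply: der_inv; [|by apply: der_sub; [exact: der_cst|exact: der_sqn_line]]; rewrite E0.
  apply: der_add; first exact: der_cst.
  apply: der_mul.
    by apply: der_sub; [|exact: der_cst]; apply: der_geo; rewrite E0.
  have -> : (fun s : R => dot (s *: v + x) v) = (fun s : R => dot v (s *: v + x)).
    by apply/funext => s; rewrite dotC.
  exact: der_dot_line.
rewrite /= E0 /geo_dd sqnE; set g := geo_d A a0 v x.
have gE : dot A v + (geo A a0 x - a0) * dot x v = g * (1 - eucl_sqnorm x) / 2.
  by rewrite /g /geo_d; field.
by rewrite gE !sqnE; rewrite sqnE in q0; field.
Qed.

Lemma der_continuous (R : realType) (f : R -> R) (t d : R) :
  der f t d -> {for t, continuous f}.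
Proof. by move=> [/derivable1_diffP df _]; exact: differentiable_continuous. Qed.

(** Restricting u - G o s to the line through x in direction v turns a local
    maximum into the second derivative test in one variable. *)
Lemma touching (R : realType) (n : nat) (u : 'rV[R]_n -> R) (A : 'rV[R]_n) (a0 : R)
    (x : 'rV[R]_n) (G dG : R -> R) (ddG d e : R) :
  Ck 2 (hyp_space R n) u -> hyp_space R n x -> 0 < d -> 0 < e ->
  (forall s, `|s - geo A a0 x| < e -> der G s (dG s)) ->
  der dG (geo A a0 x) ddG ->
  (forall y, `|y - x| < d -> hyp_space R n y ->
     u y - G (geo A a0 y) <= u x - G (geo A a0 x)) ->
  forall v,
  dir_deriv v u x = dG (geo A a0 x) * geo_d A a0 v x /\
  dir_deriv v (dir_deriv v u) x <=
    ddG * geo_d A a0 v x ^+ 2 + dG (geo A a0 x) * geo_dd A a0 v x.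
Proof.
move=> uC2 hx d0 e0 HG HdG umax v.
have E0 : 0 *: v + x = x by rewrite scale0r add0r.
have [d1 d10 Hd1] := open_dist (@hyp_space_open R n) hx.
have gc : {for 0, continuous (fun t : R => geo A a0 (t *: v + x))}.
  by apply: der_continuous; apply: der_geo; rewrite E0.
have e2 : 0 < e / 2 by rewrite divr_gt0.
have [d2 d20 Hd2] := continuous_at_dist gc e2.
pose N : R := `|v| + 1.
have N0 : 0 < N by rewrite ltr_wpDl.
pose m : R := Num.min (Num.min (d / N) (d1 / N)) d2.
have m0 : 0 < m by rewrite /m !lt_min !divr_gt0.
have near (t : R) : `|t| < m -> [/\ `|t *: v + x - x| < d, hyp_space R n (t *: v + x)
    & `|geo A a0 (t *: v + x) - geo A a0 x| < e].
  rewrite /m !lt_min => /andP[/andP[t1 t2] t3].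
  have tv : `|t *: v + x - x| <= `|t| * N.
    by rewrite addrK normrZ ler_wpM2l // lerDl.
  split.
  - by apply: le_lt_trans tv _; rewrite -ltr_pdivlMr.
  - by apply: Hd1; apply: le_lt_trans tv _; rewrite -ltr_pdivlMr.
  - have := Hd2 t; rewrite subr0 => /(_ t3); rewrite E0 => H; apply: le_lt_trans H _.
    by rewrite ltr_pdivrMr // mulr_natr mulr2n ltrDl.
have [_ C2] := uC2.
have [_ [_ C2v]] := C2 v.
pose a (t : R) : R := u (t *: v + x) - G (geo A a0 (t *: v + x)).
pose da (t : R) : R := dir_deriv v u (t *: v + x) -
  dG (geo A a0 (t *: v + x)) * geo_d A a0 v (t *: v + x).
have Ha (t : R) : `|t| < m -> der a t (da t).
  move=> /near[_ ht gt]; apply: der_sub.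
    by apply: der_line; exact: (C2 v).1.
  by apply: (der_comp (f := G)); [exact: HG|exact: der_geo].
have Hda : der da 0 (dir_deriv v (dir_deriv v u) x -
    (dG (geo A a0 x) * geo_dd A a0 v x + ddG * geo_d A a0 v x * geo_d A a0 v x)).
  apply: der_sub.
    have := @der_line R n (dir_deriv v u) x v 0.
    by rewrite E0; apply; exact: (C2v v).1.
  apply: der_eq.
    apply: der_mul; last exact: der_geo_d.
    by apply: (der_comp (f := dG)); [rewrite E0; exact: HdG|apply: der_geo; rewrite E0].
  by rewrite /= E0.
have amax (t : R) : `|t| < m -> a t <= a 0.
  by move=> /near[td ht _]; rewrite /a E0; exact: umax.
have [da0 dda0] := second_derivative_at_max m0 Ha Hda amax.
split; first by apply/eqP; rewrite -subr_eq0; move: da0; rewrite /da E0 => ->.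
by move: dda0; rewrite subr_le0 => H; apply: le_trans H _; rewrite expr2; lra.
Qed.

(** * Second derivatives in combined directions *)

Lemma dir_deriv_comb (R : realType) (n : nat) (A : set 'rV[R]_n) (f : 'rV[R]_n -> R)
    (x v w : 'rV[R]_n) (a b : R) :
  open A -> Ck 1 A f -> A x ->
  dir_deriv (a *: v + b *: w) f x = a * dir_deriv v f x + b * dir_deriv w f x.
Proof.
move=> oA C1 Ax; rewrite (deriveD_Ck1 _ _ oA C1 Ax).
have [_ C1'] := C1.
by rewrite !deriveZ_dir //; [exact: (C1' w).1|exact: (C1' v).1].
Qed.

(** The mixed derivatives are kept in both orders, so that no symmetry of
    the second derivative has to be proved. *)
Lemma dir_deriv2_comb (R : realType) (n : nat) (A : set 'rV[R]_n) (u : 'rV[R]_n -> R)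
    (x v w : 'rV[R]_n) (a b : R) :
  open A -> Ck 2 A u -> A x ->
  dir_deriv (a *: v + b *: w) (dir_deriv (a *: v + b *: w) u) x =
    a ^+ 2 * dir_deriv v (dir_deriv v u) x
    + a * b * (dir_deriv v (dir_deriv w u) x + dir_deriv w (dir_deriv v u) x)
    + b ^+ 2 * dir_deriv w (dir_deriv w u) x.
Proof.
move=> oA [cu C2] Ax.
have C1u : Ck 1 A u.
  by split=> // z; split; [exact: (C2 z).1|split=> //; have [] := (C2 z).2].
set z := a *: v + b *: w.
have nE : {near x, dir_deriv z u =1 (a *: (dir_deriv v u : _ -> R^o) + b *: (dir_deriv w u : _ -> R^o))}.
  have [d d0 Hd] := open_dist oA Ax.
  apply/nbhs_ballP; exists d => // y; rewrite -ball_normE /= distrC => /Hd Ay.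
  by rewrite /z (dir_deriv_comb _ _ _ _ oA C1u Ay).
have dv y : derivable (dir_deriv y u) x z.
  by have [_ [_ /(_ z) [+ _]]] := C2 y; apply.
have E : dir_deriv z (dir_deriv z u) x =
    a * dir_deriv z (dir_deriv v u) x + b * dir_deriv z (dir_deriv w u) x.
  rewrite {1}/dir_deriv (near_eq_derive _ nE) deriveD; last 2 first.
  - by apply: derivableZ; exact: dv.
  - by apply: derivableZ; exact: dv.
  by rewrite !deriveZ //; exact: dv.
have Ev : dir_deriv z (dir_deriv v u) x =
    a * dir_deriv v (dir_deriv v u) x + b * dir_deriv w (dir_deriv v u) x.
  exact: (dir_deriv_comb v w a b oA (C2 v).2 Ax).
have Ew : dir_deriv z (dir_deriv w u) x =
    a * dir_deriv v (dir_deriv w u) x + b * dir_deriv w (dir_deriv w u) x.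
  exact: (dir_deriv_comb v w a b oA (C2 w).2 Ax).
move: E Ev Ew; clear nE dv; clearbody z => -> -> ->.
set X1 := dir_deriv v (dir_deriv v u) x; set X2 := dir_deriv w (dir_deriv v u) x.
set X3 := dir_deriv v (dir_deriv w u) x; set X4 := dir_deriv w (dir_deriv w u) x.
by ring.
Qed.

Lemma geo_dE (R : realType) (n : nat) (A : 'rV[R]_n) (a0 : R) (x : 'rV[R]_n) (i : 'I_n) :
  geo_d A a0 (delta_mx 0 i) x =
    2 / (1 - eucl_sqnorm x) * (A + (geo A a0 x - a0) *: x) 0 i.
Proof. by rewrite /geo_d !dot_delta !mxE. Qed.

Lemma geo_d_comb (R : realType) (n : nat) (A : 'rV[R]_n) (a0 : R) (x v w : 'rV[R]_n) (a b : R) :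
  geo_d A a0 (a *: v + b *: w) x = a * geo_d A a0 v x + b * geo_d A a0 w x.
Proof. by rewrite /geo_d !dotE; ring. Qed.

Lemma sqn_delta_comb (R : realType) (n : nat) (i j : 'I_n) (a b : R) :
  eucl_sqnorm (a *: delta_mx 0 i + b *: delta_mx 0 j : 'rV[R]_n) =
    a ^+ 2 + b ^+ 2 + 2 * a * b * (i == j)%:R.
Proof.
rewrite sqnE !dotE !dot_delta !mxE !eqxx /= [j == i]eq_sym; ring.
Qed.

(** Lagrange's identity: |p|^2 tr H - p.Hp is half the sum over i, j of the
    values of the quadratic form H on the vectors p_i e_j - p_j e_i, all
    orthogonal to p. An upper bound of H in each direction therefore bounds
    this expression, which is the second-order part of the mean curvature
    that acts tangentially to the level sets. *)
Lemma lagrange_hessian (R : realType) (n : nat) (p : 'rV[R]_n) (H : 'I_n -> 'I_n -> R) :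
  \sum_i \sum_j (p 0 i ^+ 2 * H j j + p 0 i * (- p 0 j) * (H j i + H i j) + (- p 0 j) ^+ 2 * H i i)
  = 2 * (eucl_sqnorm p * (\sum_i H i i) - \sum_i p 0 i * (\sum_j p 0 j * H i j)).
Proof.
have E1 : \sum_i \sum_j p 0 i ^+ 2 * H j j = eucl_sqnorm p * \sum_i H i i.
  by rewrite /eucl_sqnorm mulr_suml; apply: eq_bigr => i _; rewrite mulr_sumr.
have E2 : \sum_i \sum_j (- p 0 j) ^+ 2 * H i i = eucl_sqnorm p * \sum_i H i i.
  rewrite exchange_big -E1; apply: eq_bigr => i _; apply: eq_bigr => j _; ring.
have E3 : \sum_i \sum_j p 0 i * (- p 0 j) * (H j i + H i j) =
    - 2 * \sum_i p 0 i * (\sum_j p 0 j * H i j).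
  have F1 : \sum_i \sum_j p 0 i * p 0 j * H i j = \sum_i p 0 i * (\sum_j p 0 j * H i j).
    by apply: eq_bigr => i _; rewrite mulr_sumr; apply: eq_bigr => j _; ring.
  have F2 : \sum_i \sum_j p 0 i * p 0 j * H j i = \sum_i p 0 i * (\sum_j p 0 j * H i j).
    rewrite -F1 exchange_big; apply: eq_bigr => i _; apply: eq_bigr => j _; ring.
  transitivity (- (\sum_i \sum_j p 0 i * p 0 j * H j i + \sum_i \sum_j p 0 i * p 0 j * H i j)).
    rewrite -big_split -sumrN; apply: eq_bigr => i _ /=.
    by rewrite -big_split -sumrN; apply: eq_bigr => j _ /=; ring.
  by rewrite F1 F2; ring.
under eq_bigr do rewrite !big_split.
by rewrite !big_split /= E1 E2 E3; ring.
Qed.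

(** Multiplying by W^3 splits the second-order part into the full trace and
    the tangential part of the Lagrange identity, both monotone in H: this
    is the ellipticity of the operator. *)
Lemma mc_term_sum (R : realType) (n : nat) (p : 'rV[R]_n) (H : 'I_n -> 'I_n -> R) (x : 'rV[R]_n) :
  let l : R := (1 - eucl_sqnorm x) / 2 in
  let W : R := Num.sqrt (1 + l ^+ 2 * eucl_sqnorm p) in
  W ^+ 3 * (\sum_i mc_term p H x i) =
  (n%:R - 2) * l * dot x p * W ^+ 2 + l ^+ 2 * (\sum_i H i i)
  + l ^+ 4 * (eucl_sqnorm p * (\sum_i H i i) - \sum_i p 0 i * (\sum_j p 0 j * H i j))
  + l ^+ 3 * dot x p * eucl_sqnorm p.
Proof.
move=> l W.
have W20 : 0 < 1 + l ^+ 2 * eucl_sqnorm p.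
  by rewrite ltr_wpDr // mulr_ge0 ?sqr_ge0 // sqn_ge0.
have W0 : W != 0 by rewrite gt_eqF // sqrtr_gt0.
have W2 : W ^+ 2 = 1 + l ^+ 2 * eucl_sqnorm p by rewrite sqr_sqrtr // ltW.
transitivity ((n%:R - 2) * l * W ^+ 2 * dot x p + l ^+ 2 * W ^+ 2 * (\sum_i H i i)
   - l ^+ 4 * (\sum_i p 0 i * (\sum_j p 0 j * H i j)) + l ^+ 3 * eucl_sqnorm p * dot x p);
  last by rewrite W2; ring.
under eq_bigr do rewrite /mc_term -/l -/W.
have [N NE] : exists N, N = eucl_sqnorm p by eexists.
rewrite -NE /dot !mulr_sumr -sumrN -!big_split /=; apply: eq_bigr => i _.
by field.
Qed.

(** * Mean curvature at a contact point with a barrier *)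

Lemma sqn_delta (R : realType) (n : nat) (i : 'I_n) : eucl_sqnorm (delta_mx 0 i : 'rV[R]_n) = 1.
Proof. by rewrite sqnE dot_delta mxE !eqxx. Qed.

(** Up to the conformal factor, A + (s - a0) x is the gradient of s, and
    |grad s|^2 = s^2 + 1 when A is normalized, as for sinh of a distance. *)
Lemma sqn_geo_grad (R : realType) (n : nat) (A : 'rV[R]_n) (a0 : R) (x : 'rV[R]_n) :
  hyp_space R n x ->
  eucl_sqnorm (A + (geo A a0 x - a0) *: x) = geo A a0 x ^+ 2 + (eucl_sqnorm A - a0 ^+ 2).
Proof.
move=> /hyp_spaceN0 q0; rewrite !sqnE !dotE [dot x A]dotC -!sqnE.
set s := geo A a0 x.
have E : dot A x = (s * (1 - eucl_sqnorm x) + a0 * (1 + eucl_sqnorm x)) / 2.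
  by rewrite /s /geo; field.
by rewrite E; field.
Qed.

Lemma dot_geo_grad (R : realType) (n : nat) (A : 'rV[R]_n) (a0 : R) (x : 'rV[R]_n) :
  hyp_space R n x ->
  dot x (A + (geo A a0 x - a0) *: x) = geo A a0 x - (1 - eucl_sqnorm x) / 2 * (geo A a0 x - a0).
Proof.
move=> /hyp_spaceN0 q0; rewrite !dotE [dot x A]dotC -!sqnE.
set s := geo A a0 x.
have E : dot A x = (s * (1 - eucl_sqnorm x) + a0 * (1 + eucl_sqnorm x)) / 2.
  by rewrite /s /geo; field.
by rewrite E; field.
Qed.

(** At the maximum, grad u is the gradient of G o s and D^2 u is at most D^2
    (G o s) in every direction; by ellipticity -Q u is then at least its
    value for G o s. That value is computed from Hess s = s g: the three
    terms come from the second derivative of G along grad s, from the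
    Laplacian of s, and from the curvature of the level sets. *)
Lemma touching_mean_curvature (R : realType) (n : nat) (u : 'rV[R]_n -> R) (A : 'rV[R]_n) (a0 : R)
    (x : 'rV[R]_n) (G dG : R -> R) (ddG d e : R) :
  Ck 2 (hyp_space R n) u -> hyp_space R n x -> 0 < d -> 0 < e ->
  (forall s, `|s - geo A a0 x| < e -> der G s (dG s)) ->
  der dG (geo A a0 x) ddG ->
  (forall y, `|y - x| < d -> hyp_space R n y ->
     u y - G (geo A a0 y) <= u x - G (geo A a0 x)) ->
  forall s Z k : R, s = geo A a0 x -> Z = s ^+ 2 + (eucl_sqnorm A - a0 ^+ 2) -> k = - dG s ->
  - ddG * Z + n%:R * s * k + (n%:R - 1) * k ^+ 3 * s * Z <=
  Num.sqrt (1 + k ^+ 2 * Z) ^+ 3 * (- hyp_mean_curvature u x).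
Proof.
move=> uC2 hx d0 e0 HG HdG umax s Z k sdef Zdef kdef.
have kE : dG s = - k by rewrite kdef opprK.
have T := touching uC2 hx d0 e0 HG HdG umax.
have q0 := hyp_spaceN0 hx.
have qpos : 0 < 1 - eucl_sqnorm x by rewrite subr_gt0.
pose l : R := (1 - eucl_sqnorm x) / 2.
have l0 : 0 < l by rewrite divr_gt0.
have ln0 : l != 0 by rewrite gt_eqF.
have lV : 2 / (1 - eucl_sqnorm x) = l^-1 by rewrite /l invf_div.
have [z zE] : exists z : 'rV[R]_n, z = A + (s - a0) *: x by eexists.
have zZ : eucl_sqnorm z = Z by rewrite zE Zdef sdef; exact: sqn_geo_grad.
pose X : R := dot x z.
have XE : X = s - l * (s - a0) by rewrite /X zE sdef; exact: dot_geo_grad.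
have [p pdef] : exists p : 'rV[R]_n, p = eucl_grad u x by eexists.
have pE i : p 0 i = - k * l^-1 * z 0 i.
  by rewrite pdef zE mxE (T (delta_mx 0 i)).1 geo_dE lV -sdef kE -mulrA.
have sE i : geo_d A a0 (delta_mx 0 i) x = l^-1 * z 0 i by rewrite geo_dE lV zE sdef.
have pz : p = (- k * l^-1) *: z by apply/rowP => i; rewrite pE !mxE.
have PP : eucl_sqnorm p = k ^+ 2 / l ^+ 2 * Z.
  by rewrite pz sqnE !dotE -sqnE zZ; field.
have xp : dot x p = - k / l * X by rewrite pz dotE.
pose H (i j : 'I_n) : R := dir_deriv (delta_mx 0 i) (dir_deriv (delta_mx 0 j) u) x.
have Q : hyp_mean_curvature u x = \sum_i mc_term p H x i by rewrite pdef; exact: mean_curvature_expand.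
have tr : \sum_i H i i <= ddG / l ^+ 2 * Z - k / l * (2 / l * X + n%:R * (s - a0)).
  apply: le_trans (_ : \sum_i (ddG / l ^+ 2 * z 0 i ^+ 2 -
     k / l * (2 / l * (x 0 i * z 0 i) + (s - a0))) <= _).
    apply: ler_sum => i _; apply: le_trans (T (delta_mx 0 i)).2 _.
    rewrite /geo_dd lV sE dot_delta sqn_delta -sdef kE le_eqVlt; apply/orP; left; apply/eqP.
    by field.
  rewrite big_split sumrN -!mulr_sumr big_split -mulr_sumr sumr_const card_ord -zZ /=.
  by rewrite -[(s - a0) *+ n]mulr_natl; exact: lexx.
(* The vectors p_i e_j - p_j e_i are orthogonal to the gradient of s,
   so G'' does not contribute to the second derivatives along them. *)
have lagr : l ^+ 4 * (eucl_sqnorm p * (\sum_i H i i) - \sum_i p 0 i * (\sum_j p 0 j * H i j)) <=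
    l ^+ 4 * (- k / l * (s - a0) * (n%:R - 1) * eucl_sqnorm p).
  rewrite ler_pM2l ?exprn_gt0 // -(@ler_pM2l _ 2) // -lagrange_hessian.
  apply: le_trans (_ : \sum_i \sum_j (- k / l * (s - a0) *
     (p 0 i ^+ 2 + p 0 j ^+ 2 - 2 * (p 0 i * p 0 j * (j == i)%:R))) <= _).
    apply: ler_sum => i _; apply: ler_sum => j _.
    have := (T (p 0 i *: delta_mx 0 j + (- p 0 j) *: delta_mx 0 i)).2.
    rewrite (dir_deriv2_comb _ _ _ _ (@hyp_space_open R n) uC2 hx) -/(H j j) -/(H i i)
      -/(H i j) -/(H j i) => H1; apply: le_trans H1 _.
    rewrite /geo_dd geo_d_comb !sE lV.
    have -> : p 0 i * (l^-1 * z 0 j) + - p 0 j * (l^-1 * z 0 i) = 0 by rewrite !pE; ring.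
    rewrite sqn_delta_comb -sdef kE le_eqVlt; apply/orP; left; apply/eqP.
    by field.
  under eq_bigr do rewrite -mulr_sumr.
  rewrite -mulr_sumr.
  have -> : \sum_i \sum_j (p 0 i ^+ 2 + p 0 j ^+ 2 - 2 * (p 0 i * p 0 j * (j == i)%:R)) =
     2 * (n%:R - 1) * eucl_sqnorm p.
    have inner i : \sum_j (p 0 i ^+ 2 + p 0 j ^+ 2 - 2 * (p 0 i * p 0 j * (j == i)%:R)) =
        (n%:R - 2) * p 0 i ^+ 2 + eucl_sqnorm p.
      rewrite !big_split /= sumr_const card_ord sumrN -[_ *+ n]mulr_natl -/(eucl_sqnorm p).
      have -> : \sum_j 2 * (p 0 i * p 0 j * (j == i)%:R) = 2 * p 0 i ^+ 2.
        rewrite (bigD1 i) //= big1 ?eqxx ?addr0 ?mulr1 -?expr2 // => j /negbTE ->.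
        by rewrite !mulr0.
      by ring.
    under eq_bigr do rewrite inner.
    rewrite big_split /= sumr_const card_ord -mulr_sumr -[_ *+ n]mulr_natl -/(eucl_sqnorm p).
    by ring.
  by rewrite le_eqVlt; apply/orP; left; apply/eqP; ring.
have W2 : Num.sqrt (1 + k ^+ 2 * Z) = Num.sqrt (1 + l ^+ 2 * eucl_sqnorm p).
  by rewrite PP; congr Num.sqrt; field.
have := mc_term_sum p H x; rewrite /= -/l => M; rewrite W2 Q mulrN M.
have Z0 : 0 <= Z by rewrite -zZ sqn_ge0.
have W2' : Num.sqrt (1 + l ^+ 2 * eucl_sqnorm p) ^+ 2 = 1 + k ^+ 2 * Z.
  rewrite -W2 sqr_sqrtr // addr_ge0 // mulr_ge0 // sqr_ge0 //.
rewrite W2'.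
have tr' : l ^+ 2 * (\sum_i H i i) <= ddG * Z - k * (2 * X + n%:R * (l * (s - a0))).
  apply: le_trans (_ : l ^+ 2 * (ddG / l ^+ 2 * Z - k / l * (2 / l * X + n%:R * (s - a0))) <= _).
    by rewrite ler_pM2l // exprn_gt0.
  by rewrite le_eqVlt; apply/orP; left; apply/eqP; field.
move: lagr tr'; set L1 := l ^+ 4 * (_ - _); set L2 := l ^+ 2 * (\sum_i _) => lagr tr'.
have E1 : l ^+ 4 * (- k / l * (s - a0) * (n%:R - 1) * eucl_sqnorm p) =
   - k ^+ 3 * Z * (n%:R - 1) * (s - X).
  by rewrite PP XE; field.
have E2 : l * dot x p = - k * X by rewrite xp; field.
have E3 : l ^+ 3 * dot x p * eucl_sqnorm p = - k ^+ 3 * X * Z by rewrite xp PP; field.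
rewrite E3 -[(n%:R - 2) * l * _]mulrA E2.
rewrite E1 in lagr.
have E4 : l * (s - a0) = s - X by rewrite XE; ring.
rewrite E4 in tr'.
rewrite lerNr; apply: le_trans (lerD (lerD (lerD (lexx _) tr') lagr) (lexx _)) _.
by rewrite le_eqVlt; apply/orP; left; apply/eqP; ring.
Qed.

(** * The comparison principle *)

Lemma cts_add (R : realType) (T : topologicalType) (f g : T -> R) (x : T) :
  {for x, continuous f} -> {for x, continuous g} -> {for x, continuous (fun y => f y + g y)}.
Proof. by move=> cf cg; apply: cvgD. Qed.

Lemma cts_sub (R : realType) (T : topologicalType) (f g : T -> R) (x : T) :
  {for x, continuous f} -> {for x, continuous g} -> {for x, continuous (fun y => f y - g y)}.
Proof. by move=> cf cg; apply: cvgB. Qed.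

Lemma cts_mul (R : realType) (T : topologicalType) (f g : T -> R) (x : T) :
  {for x, continuous f} -> {for x, continuous g} -> {for x, continuous (fun y => f y * g y)}.
Proof. by move=> cf cg; apply: cvgM. Qed.

Lemma cts_inv (R : realType) (T : topologicalType) (f : T -> R) (x : T) : f x != 0 ->
  {for x, continuous f} -> {for x, continuous (fun y => (f y)^-1)}.
Proof. by move=> fx cf; apply: cvgV. Qed.

Lemma cts_cst (R : realType) (T : topologicalType) (c : R) (x : T) :
  {for x, continuous (fun _ : T => c)}.
Proof. exact: cvg_cst. Qed.

Lemma norm_sqr_le_sqn (R : realType) (n : nat) (x : 'rV[R]_n) : `|x| ^+ 2 <= eucl_sqnorm x.
Proof.
rewrite [`|x|](_ : _ = mx_norm x) //.
have [->|x0] := eqVneq (mx_norm x) 0; first by rewrite expr0n sqn_ge0.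
have [[i j] /= ->] := mx_norm_neq0 x0.
rewrite ord1 real_normK ?num_real // /eucl_sqnorm (bigD1 j) //= lerDl.
by apply: sumr_ge0 => k _; exact: sqr_ge0.
Qed.

Lemma norm_lt_sqn (R : realType) (n : nat) (x : 'rV[R]_n) (d : R) :
  0 < d -> eucl_sqnorm x < d ^+ 2 -> `|x| < d.
Proof.
move=> d0 xd; rewrite -(@ltr_pXn2r _ 2) ?nnegrE // ?ltW //.
exact: le_lt_trans (norm_sqr_le_sqn x) xd.
Qed.

Lemma closure_dist (R : realType) (V : normedModType R) (K : set V) (y : V) (d : R) :
  closure K y -> 0 < d -> exists2 x, K x & `|x - y| < d.
Proof.
move=> Ky d0; have [x [Kx xd]] := Ky (ball y d) (nbhsx_ballx y d d0).
by exists x => //; move: xd; rewrite -ball_normE /= distrC.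
Qed.

Lemma geo_continuous (R : realType) (n : nat) (A : 'rV[R]_n) (a0 : R) (x : 'rV[R]_n) :
  hyp_space R n x -> {for x, continuous (geo A a0)}.
Proof.
move=> /hyp_spaceN0 q0; have cq := @sqn_continuous R n x.
apply: cts_mul; last by apply: cts_inv => //; apply: cts_sub => //; exact: cts_cst.
apply: cts_sub; first by apply: cts_mul; [exact: cts_cst|exact: dot_continuous].
by apply: cts_mul; [exact: cts_cst|apply: cts_add => //; exact: cts_cst].
Qed.

(** At a positive maximum of u - G o s the strict inequality for G
    contradicts the bound for Q u. The maximum is attained because the
    condition at the boundary of V makes the set where u - G o s >= e
    compact. *)
Lemma comparison (R : realType) (n : nat) (u F : 'rV[R]_n -> R) (A : 'rV[R]_n) (a0 : R)
    (V : set 'rV[R]_n) (G dG ddG : R -> R) :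
  eucl_sqnorm A - a0 ^+ 2 = 1 ->
  Ck 2 (hyp_space R n) u -> open V -> V `<=` hyp_space R n ->
  (forall x, V x -> - hyp_mean_curvature u x <= F x) ->
  (forall x, V x -> exists2 e : R, 0 < e &
     forall s, `|s - geo A a0 x| < e -> der G s (dG s)) ->
  (forall x, V x -> der dG (geo A a0 x) (ddG (geo A a0 x))) ->
  (forall x s k : _, V x -> s = geo A a0 x -> k = - dG s ->
     F x * Num.sqrt (1 + k ^+ 2 * (s ^+ 2 + 1)) ^+ 3 <
     - ddG s * (s ^+ 2 + 1) + n%:R * s * k + (n%:R - 1) * k ^+ 3 * s * (s ^+ 2 + 1)) ->
  (forall y e, closure V y -> ~ V y -> 0 < e ->
     exists2 d : R, 0 < d & forall x, V x -> `|x - y| < d -> u x - G (geo A a0 x) < e) ->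
  forall x, V x -> u x <= G (geo A a0 x).
Proof.
move=> A1 uC2 oV sV uF HG HdG strict bnd x1 Vx1; rewrite leNgt; apply/negP => ux1.
pose g y : R := u y - G (geo A a0 y).
(* Half of the positive value, so that the level set contains x1 and
   yet stays away from the boundary of V. *)
pose e : R := g x1 / 2.
have g1 : 0 < g x1 by rewrite /g subr_gt0.
have e0 : 0 < e by rewrite divr_gt0.
have e1 : e < g x1 by rewrite ltr_pdivrMr // mulr_natr mulr2n ltrDl.
have gc x : V x -> {for x, continuous g}.
  move=> Vx; apply: cts_sub; first by case: uC2 => + _; apply; exact: sV.
  apply: (@continuous_comp _ _ _ (geo A a0) G); first by apply: geo_continuous; exact: sV.
  have [d d0 Hd] := HG x Vx.
  by apply: der_continuous; apply: Hd; rewrite subrr normr0.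
pose K : set 'rV[R]_n := [set x | V x /\ e <= g x].
have cK : closed K.
  move=> y Ky.
  have cVy : closure V y by move=> B /Ky [z [[Vz _] Bz]]; exists z.
  have [Vy|nVy] := pselect (V y).
    split=> //; rewrite leNgt; apply/negP => gy.
    have h0 : 0 < (e - g y) / 2 by rewrite divr_gt0 // subr_gt0.
    have [d d0 Hd] := continuous_at_dist (gc y Vy) h0.
    have [z [Vz gz] zy] := closure_dist Ky d0.
    have := Hd z zy; rewrite ler_norml => /andP[_].
    by move: gz h0; rewrite /g; lra.
  have [d d0 Hd] := bnd y e cVy nVy e0.
  have [z [Vz gz] zy] := closure_dist Ky d0.
  by have := Hd z Vz zy; rewrite ltNge gz.
have bK : bounded_set K.
  exists 1; split=> // M M1 x [/sV hx _] /=.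
  apply/ltW/(lt_trans _ M1); apply: norm_lt_sqn => //.
  by rewrite expr1n.
have KK := bounded_closed_compact bK cK.
have K1 : K x1 by split=> //; exact: ltW.
have [x0 + x0max] : exists2 c, c \in K & forall t, t \in K -> g t <= g c.
  apply: EVT_max_rV => //; first by exists x1.
  by apply: continuous_in_subspaceT => x; rewrite inE => -[Vx _]; exact: gc.
rewrite inE => -[Vx0 gx0].
have [d d0 Hd] := open_dist oV Vx0.
have umax y : `|y - x0| < d -> hyp_space R n y ->
    u y - G (geo A a0 y) <= u x0 - G (geo A a0 x0).
  move=> /Hd Vy _; rewrite -!/(g _).
  have [ey|ye] := leP e (g y); first by apply: x0max; rewrite inE.
  exact: le_trans (ltW ye) gx0.
have [r r0 Hr] := HG x0 Vx0.
have := touching_mean_curvature uC2 (sV _ Vx0) d0 r0 Hr (HdG _ Vx0) umax erefl erefl erefl.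
rewrite A1 => T; have := strict x0 _ _ Vx0 erefl erefl.
rewrite ltNge => /negP; apply; apply: le_trans T _.
by rewrite mulrC ler_wpM2r //; exact: uF.
Qed.

(** * Barrier that is infinite on an equidistant hypersurface *)

(** The first term is infinite at s = 2. The second has slope of order K0/(s
    (4 + t^2)) with t = ln s - D, the size of the prescribed decay divided
    by s, and it is bounded because 1/(4 + t^2) is integrable. *)
Definition scherk (R : realType) (K0 D s : R) : R :=
  10 / Num.sqrt (s - 2) + 17 * K0 * (pi / 2 - atan ((ln s - D) / 2)).

Definition scherk_d (R : realType) (K0 D s : R) : R :=
  - (5 / ((s - 2) * Num.sqrt (s - 2)) + 34 * K0 / (s * (4 + (ln s - D) ^+ 2))).

Definition scherk_dd (R : realType) (K0 D s : R) : R :=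
  15 / 2 / ((s - 2) ^+ 2 * Num.sqrt (s - 2))
  + 34 * K0 / (s * (4 + (ln s - D) ^+ 2)) / s * (1 + 2 * (ln s - D) / (4 + (ln s - D) ^+ 2)).

Lemma sqr4_gt0 (R : realType) (t : R) : 0 < 4 + t ^+ 2.
Proof. by rewrite ltr_wpDr // sqr_ge0. Qed.

Lemma der_scherk (R : realType) (K0 D s : R) : 2 < s ->
  der (scherk K0 D) s (scherk_d K0 D s).
Proof.
move=> s2; have s0 : 0 < s by lra.
have y0 : 0 < s - 2 by rewrite subr_gt0.
have r0 : 0 < Num.sqrt (s - 2) by rewrite sqrtr_gt0.
have rr : Num.sqrt (s - 2) ^+ 2 = s - 2 by rewrite sqr_sqrtr // ltW.
have t4 := sqr4_gt0 (ln s - D).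
have ds : der (fun s : R => s - 2) s (1 - 0) by apply: der_sub; [exact: der_id|exact: der_cst].
apply: der_eq.
  apply: der_add.
    by apply: der_scale; apply: der_inv; [rewrite gt_eqF|apply: der_sqrt; [exact: y0|exact: ds]].
  apply: der_scale; apply: der_sub; first exact: der_cst.
  apply: der_comp; first exact: is_derive1_atan.
  apply: der_mul; last exact: der_cst.
  by apply: der_sub; [exact: is_derive1_ln|exact: der_cst].
rewrite /= /scherk_d; set r : R := Num.sqrt _ in r0 rr *; rewrite -!rr; set t : R := ln s - D in t4 *.
have -> : 1 + (t / 2) ^+ 2 = (4 + t ^+ 2) / 4 by field.
by field; rewrite !gt_eqF.
Qed.

Lemma der_scherk_d (R : realType) (K0 D s : R) : 2 < s ->
  der (scherk_d K0 D) s (scherk_dd K0 D s).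
Proof.
move=> s2; have s0 : 0 < s by lra.
have y0 : 0 < s - 2 by rewrite subr_gt0.
have r0 : 0 < Num.sqrt (s - 2) by rewrite sqrtr_gt0.
have rr : Num.sqrt (s - 2) ^+ 2 = s - 2 by rewrite sqr_sqrtr // ltW.
have t4 := sqr4_gt0 (ln s - D).
have ds : der (fun s : R => s - 2) s (1 - 0) by apply: der_sub; [exact: der_id|exact: der_cst].
apply: der_eq.
  apply: der_opp; apply: der_add; apply: der_scale; apply: der_inv.
  - by rewrite gt_eqF // mulr_gt0.
  - by apply: der_mul; [exact: ds|apply: der_sqrt; [exact: y0|exact: ds]].
  - by rewrite gt_eqF // mulr_gt0.
  - apply: der_mul; first exact: der_id.
    apply: der_add; first exact: der_cst.
    apply: der_exp; apply: der_sub; [exact: is_derive1_ln|exact: der_cst].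
rewrite /= /scherk_dd; set r : R := Num.sqrt _ in r0 rr *; rewrite -!rr; set t := ln s - D in t4 *.
by field; rewrite !gt_eqF.
Qed.

Lemma scherk_gt0 (R : realType) (K0 D s : R) : 0 <= K0 -> 10 / Num.sqrt (s - 2) <= scherk K0 D s.
Proof.
move=> K0_ge0; rewrite /scherk lerDl mulr_ge0 ?mulr_ge0 // subr_ge0 ltW //.
by have := atan_ltpi2 ((ln s - D) / 2).
Qed.

Lemma cube_sqrt_le (R : realType) (m w : R) : 0 <= w -> 1 + m <= (1 + w) ^+ 2 ->
  Num.sqrt (1 + m) ^+ 3 <= (1 + w) ^+ 3.
Proof.
move=> w0 mw; rewrite lerXn2r ?nnegrE ?sqrtr_ge0 ?addr_ge0 //.
by rewrite -[leRHS]ger0_norm ?addr_ge0 // -sqrtr_sqr ler_wsqrtr.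
Qed.

Lemma cube_add_le (R : realType) (w : R) : 0 <= w -> (1 + w) ^+ 3 <= 4 * (1 + w ^+ 3).
Proof.
move=> w0; rewrite -subr_ge0.
have -> : 4 * (1 + w ^+ 3) - (1 + w) ^+ 3 = 3 * ((1 + w) * (1 - w) ^+ 2) by ring.
by rewrite mulr_ge0 // mulr_ge0 ?sqr_ge0 // addr_ge0.
Qed.

(** Write the slope as k = a + b, with a from the square-root term and b
    from the arctangent term. The left-hand side is at most 4 F + 8 F (k
    s)^3. The first summand is paid by the linear terms in b, because F <= b
    s/34, and the second by half of the cubic term, because F <= 1/16. The
    other half of the cubic term pays for the second derivative of the
    square-root term. *)
Lemma scherk_ineq (R : realType) (N K0 D s F : R) : 2 <= N -> 0 < K0 -> 2 < s -> 0 <= F ->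
  F <= 1 / 16 -> F <= K0 / (4 + (ln s - D) ^+ 2) ->
  forall k : R, k = - scherk_d K0 D s ->
  F * Num.sqrt (1 + k ^+ 2 * (s ^+ 2 + 1)) ^+ 3 <
  (- scherk_dd K0 D s * (s ^+ 2 + 1) + N * s * k + (N - 1) * k ^+ 3 * s * (s ^+ 2 + 1) : R).
Proof.
move=> N2 K0p s2 F0 F1 F2 k kdef.
have s0 : 0 < s by lra.
have y0 : 0 < s - 2 by rewrite subr_gt0.
have r0 : 0 < Num.sqrt (s - 2) by rewrite sqrtr_gt0.
have rr : Num.sqrt (s - 2) ^+ 2 = s - 2 by rewrite sqr_sqrtr // ltW.
have t4 := sqr4_gt0 (ln s - D).
set t := ln s - D in F2 t4 *.
pose a : R := 5 / ((s - 2) * Num.sqrt (s - 2)).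
pose b : R := 34 * K0 / (s * (4 + t ^+ 2)).
have kE : k = a + b by rewrite kdef /scherk_d opprK.
have a0 : 0 < a by rewrite divr_gt0 // mulr_gt0.
have b0 : 0 < b by rewrite divr_gt0 ?mulr_gt0.
(* With y = s - 2, a^3 = 25 a/y^3 dominates for small y the second
   derivative of the square-root term, which is of order a/y. *)
have a2 : a ^+ 2 * (s - 2) ^+ 3 = 25.
  rewrite /a; set r : R := Num.sqrt _ in r0 rr *.
  by rewrite -!rr; field; rewrite gt_eqF.
pose th : R := 2 * t / (4 + t ^+ 2).
(* th <= 1/2 because (t - 2)^2 >= 0; it leaves a part of the linear
   term for F. *)
have th1 : th <= 1 / 2.
  rewrite /th ler_pdivrMr // -subr_ge0.
  by have -> : 1 / 2 * (4 + t ^+ 2) - 2 * t = (t - 2) ^+ 2 / 2; [field|rewrite divr_ge0 ?sqr_ge0].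
have ddE : scherk_dd K0 D s = 3 / 2 * a / (s - 2) + b / s * (1 + th).
  rewrite /scherk_dd -/t -/b -/th; congr (_ + _); rewrite /a; field.
  by rewrite !gt_eqF.
have Fb : F <= b * s / 34.
  by apply: le_trans F2 _; rewrite le_eqVlt; apply/orP; left; apply/eqP; rewrite /b; field; rewrite !gt_eqF.
have k0 : 0 < k by rewrite kE addr_gt0.
(* As s > 2, s^2 + 1 <= (5/4)^2 s^2, so that W <= 1 + w. *)
pose w : R := 5 / 4 * k * s.
have ks0 : 0 < k * s by rewrite mulr_gt0.
have w0 : 0 <= w by rewrite ltW // !mulr_gt0.
have W3 : Num.sqrt (1 + k ^+ 2 * (s ^+ 2 + 1)) ^+ 3 <= 4 + 8 * (k * s) ^+ 3.
  apply: le_trans (cube_sqrt_le w0 _) _.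
    have : k ^+ 2 * (s ^+ 2 + 1) <= k ^+ 2 * (25 / 16 * s ^+ 2).
      by rewrite ler_pM2l ?exprn_gt0 //; nra.
    have -> : (1 + w) ^+ 2 = 1 + k ^+ 2 * (25 / 16 * s ^+ 2) + 5 / 2 * (k * s).
      by rewrite /w; field.
    by move=> H; lra.
  apply: le_trans (cube_add_le w0) _.
  have : 0 < (k * s) ^+ 3 by rewrite exprn_gt0 // mulr_gt0.
  by rewrite /w (_ : (5 / 4 * k * s) ^+ 3 = 125 / 64 * (k * s) ^+ 3); [lra|field].
have FW : F * Num.sqrt (1 + k ^+ 2 * (s ^+ 2 + 1)) ^+ 3 <= 4 * (b * s / 34) + 1 / 2 * (k * s) ^+ 3.
  apply: le_trans (ler_wpM2l F0 W3) _.
  have : 0 < (k * s) ^+ 3 by rewrite exprn_gt0 // mulr_gt0.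
  by move=> H; rewrite mulrDr lerD //; [lra|nra].
apply: le_lt_trans FW _.
rewrite ddE.
have bpart : b / s * (1 + th) * (s ^+ 2 + 1) <= 2 * s * b - b * s / 8.
  have -> : b / s * (1 + th) * (s ^+ 2 + 1) = b * ((1 + th) * (s + s^-1)) by field; rewrite gt_eqF.
  have -> : 2 * s * b - b * s / 8 = b * (15 / 8 * s) by field.
  rewrite ler_pM2l //.
  have v0 : 0 < s^-1 by rewrite invr_gt0.
  have vs : s^-1 * s = 1 by rewrite mulVf // gt_eqF.
  set v := s^-1 in v0 vs *.
  have : 0 <= v * ((s - 2) * (s + 2)) by rewrite ltW // !mulr_gt0 //; lra.
  have -> : v * ((s - 2) * (s + 2)) = v * s * s - 4 * v by ring.
  rewrite vs => sV.
  have : 0 <= (1 / 2 - th) * (s + v) by rewrite mulr_ge0 ?subr_ge0 // addr_ge0 // ltW.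
  by move=> H; lra.
have apart : 3 / 2 * a / (s - 2) * (s ^+ 2 + 1) <= 2 * s * a + 1 / 2 * a ^+ 3 * s * (s ^+ 2 + 1).
  set y := s - 2 in y0 a2 *.
  have sy : s = y + 2 by rewrite /y; ring.
  have -> : 2 * s * a + 1 / 2 * a ^+ 3 * s * (s ^+ 2 + 1) =
     a / y * (2 * s * y + 25 / 2 * s * (s ^+ 2 + 1) / y ^+ 2).
    by rewrite (_ : a ^+ 3 = a * 25 / y ^+ 3); [field; rewrite gt_eqF|rewrite -a2; field; rewrite gt_eqF].
  have -> : 3 / 2 * a / y * (s ^+ 2 + 1) = a / y * (3 / 2 * (s ^+ 2 + 1)) by field; rewrite gt_eqF.
  rewrite (ler_pM2l (divr_gt0 a0 y0)).
  (* For large s the linear term 2 s a absorbs the second derivative;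
     for bounded s the cubic term does. *)
  have [s9|s9] := leP 9 s.
    have : 0 <= 25 / 2 * s * (s ^+ 2 + 1) / y ^+ 2.
      by rewrite divr_ge0 ?sqr_ge0 // !mulr_ge0 ?addr_ge0 ?sqr_ge0 // ltW.
    by move=> H; nra.
  have : 3 / 2 * (s ^+ 2 + 1) <= 25 / 2 * s * (s ^+ 2 + 1) / y ^+ 2.
    rewrite ler_pdivlMr ?exprn_gt0 //.
    have : 3 / 2 * y ^+ 2 <= 25 / 2 * s by nra.
    have q0 : 0 < s ^+ 2 + 1 by rewrite ltr_wpDl // sqr_ge0.
    by move=> H; have := ler_wpM2r (ltW q0) H; lra.
  by have := mulr_gt0 s0 y0; lra.
have k3 : a ^+ 3 <= k ^+ 3 by rewrite lerXn2r ?nnegrE ?ltW // kE ltrDl.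
have bs : 0 < b * s by rewrite mulr_gt0.
have s1 : 0 < s * (s ^+ 2 + 1) by rewrite mulr_gt0 // ltr_wpDl // sqr_ge0.
have Ns : 2 * s * k <= N * s * k by rewrite !ler_pM2r.
have ks : k ^+ 3 * (s * (s ^+ 2 + 1)) <= (N - 1) * k ^+ 3 * s * (s ^+ 2 + 1).
  have M0 : 0 < k ^+ 3 * (s * (s ^+ 2 + 1)) by rewrite mulr_gt0 // exprn_gt0.
  have -> : (N - 1) * k ^+ 3 * s * (s ^+ 2 + 1) = (N - 1) * (k ^+ 3 * (s * (s ^+ 2 + 1))) by ring.
  by rewrite -[leLHS]mul1r ler_pM2r //; lra.
have ks2 : a ^+ 3 * (s * (s ^+ 2 + 1)) <= k ^+ 3 * (s * (s ^+ 2 + 1)) by rewrite ler_pM2r.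
have ks3 : (k * s) ^+ 3 <= k ^+ 3 * (s * (s ^+ 2 + 1)).
  rewrite exprMn ler_pM2l ?exprn_gt0 //; nra.
have kk : 2 * s * k = 2 * s * a + 2 * s * b by rewrite kE; ring.
rewrite mulNr mulrDl.
move: apart; rewrite -(mulrA (1 / 2 * a ^+ 3)) -(mulrA (1 / 2)) => apart.
lra.
Qed.

(** * Barrier with a strictly positive drop, and comparison with the infinite one *)

(** For the exponential profile the second derivative is N k, and N k (s^2 +
    1) + N s k = N k (s^2 + s + 1) is positive whatever the sign of s; the
    cubic term is negligible for small slopes. *)
Lemma hopf_ineq (R : realType) (N s F k : R) : 1 <= N -> 0 < k ->
  -3 <= s -> 0 <= F -> k ^+ 2 * (s ^+ 2 + 1) <= 1 / 12 -> 16 * F < k ->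
  F * Num.sqrt (1 + k ^+ 2 * (s ^+ 2 + 1)) ^+ 3 <
  (N * k * (s ^+ 2 + 1) + N * s * k + (N - 1) * k ^+ 3 * s * (s ^+ 2 + 1) : R).
Proof.
move=> N1 k0 s3 F0 ksm Fk.
have W3 : Num.sqrt (1 + k ^+ 2 * (s ^+ 2 + 1)) ^+ 3 <= (1 + 1) ^+ 3.
  by apply: cube_sqrt_le => //; lra.
apply: le_lt_trans (ler_wpM2l F0 W3) _.
apply: (@lt_le_trans _ _ (N * k / 2)); first by rewrite (_ : (1 + 1) ^+ 3 = 8 :> R); [nra|ring].
set m := k ^+ 2 * (s ^+ 2 + 1) in ksm *.
have m0 : 0 <= m by rewrite mulr_ge0 ?sqr_ge0 // addr_ge0 ?sqr_ge0.
have -> : (N - 1) * k ^+ 3 * s * (s ^+ 2 + 1) = (N - 1) * k * (s * m) by rewrite /m; ring.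
have sm : -1 / 4 <= s * m by nra.
have Nk : 0 <= (N - 1) * k by rewrite mulr_ge0 ?subr_ge0 // ltW.
have := ler_wpM2l Nk sm.
have : 0 < N * k by nra.
have -> : N * k * (s ^+ 2 + 1) + N * s * k = N * k * (s ^+ 2 + s + 1) by ring.
have s34 : 3 / 4 <= s ^+ 2 + s + 1 by have := sqr_ge0 (s + 1 / 2); lra.
move=> NK H; have := ler_wpM2l (ltW NK) s34; lra.
Qed.

Lemma inv_sqrt_ge (R : realType) (b y : R) : 0 < b -> 0 < y -> y <= (b ^+ 2)^-1 -> b <= 10 / Num.sqrt y.
Proof.
move=> b0 y0 yb.
have r0 : 0 < Num.sqrt y by rewrite sqrtr_gt0.
rewrite ler_pdivlMr //.
have rr : Num.sqrt y ^+ 2 = y by rewrite sqr_sqrtr // ltW.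
have : (b * Num.sqrt y) ^+ 2 <= 1.
  by rewrite exprMn rr -ler_pdivlMl ?exprn_gt0 // mulr1.
have : 0 < b * Num.sqrt y by rewrite mulr_gt0.
set q := b * _; nra.
Qed.

(** Where s tends to 2 the barrier tends to infinity and u stays bounded, so
    u only has to be controlled on the rest of the boundary: on the sphere
    at infinity and on the boundary of O. *)
Lemma scherk_bound (R : realType) (n : nat) (u F : 'rV[R]_n -> R) (A : 'rV[R]_n) (a0 : R)
    (O : set 'rV[R]_n) (K0 D M : R) :
  (2 <= n)%N -> eucl_sqnorm A - a0 ^+ 2 = 1 -> 0 < K0 ->
  Ck 2 (hyp_space R n) u -> open O ->
  (forall x, hyp_space R n x -> - hyp_mean_curvature u x <= F x) ->
  let V : set 'rV[R]_n := [set x | [/\ hyp_space R n x, O x & 2 < geo A a0 x]] in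
  (forall x, V x -> [/\ 0 <= F x, F x <= 1 / 16 &
     F x <= K0 / (4 + (ln (geo A a0 x) - D) ^+ 2)]) ->
  (forall y e, closure V y -> ~ (hyp_space R n y /\ O y) -> 0 < e ->
     exists2 d : R, 0 < d & forall x, V x -> `|x - y| < d -> u x < M + e) ->
  forall x, V x -> u x <= M + scherk K0 D (geo A a0 x).
Proof.
move=> n2 A1 K00 uC2 oO uF V HF bnd.
have oV : open V.
  have -> : V = O `&` [set x | hyp_space R n x /\ 2 < geo A a0 x].
    by apply/seteqP; split => x /= [] => [? ? ?|? [? ?]].
  apply: openI => //; rewrite openE => x [hx gx].
  have [d d0 Hd] := open_dist (@hyp_space_open R n) hx.
  have h0 : 0 < (geo A a0 x - 2) / 2 by rewrite divr_gt0 // subr_gt0.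
  have [r r0 Hr] := continuous_at_dist (geo_continuous (A := A) (a0 := a0) hx) h0.
  apply/nbhs_ballP; exists (Num.min d r); first by rewrite /= lt_min d0.
  move=> y; rewrite -ball_normE /= distrC lt_min => /andP[yd yr].
  split; first exact: Hd.
  by have := Hr y yr; rewrite ler_norml => /andP[+ _] => H; lra.
pose G (s : R) : R := M + scherk K0 D s.
refine (@comparison R n u F A a0 V G (scherk_d K0 D) (scherk_dd K0 D) A1 uC2 oV _ _ _ _ _ _).
- by move=> x [].
- by move=> x [hx _ _]; exact: uF.
- move=> x [_ _ gx]; exists (geo A a0 x - 2); first by rewrite subr_gt0.
  move=> s; rewrite ltr_norml => /andP[s1 s2].
  apply: (@der_eq _ _ _ (0 + scherk_d K0 D s)); last by rewrite add0r.
  by apply: der_add; [exact: der_cst|apply: der_scherk; lra].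
- by move=> x [_ _ gx]; exact: der_scherk_d.
- move=> x s k Vx -> ->; have [F0 F1 F2] := HF x Vx; have [_ _ gx] := Vx.
  by apply: scherk_ineq => //; rewrite ler_nat.
move=> y e cVy nVy e0.
have G0 x : V x -> M <= G (geo A a0 x).
  move=> [_ _ gx]; rewrite /G lerDl; apply: le_trans (scherk_gt0 _ _ (ltW K00)).
  by rewrite divr_ge0 // sqrtr_ge0.
have [[hy Oy]|ny] := pselect (hyp_space R n y /\ O y); last first.
  have [d d0 Hd] := bnd y e cVy ny e0.
  exists d => // x Vx /(Hd _ Vx) ux; have := G0 x Vx; lra.
have gy : geo A a0 y <= 2 by rewrite leNgt; apply/negP => gy; apply: nVy.
have uc : {for y, continuous u} by case: uC2 => + _; apply.
have [d1 d10 H1] := continuous_at_dist uc ltr01.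
(* Near y the barrier exceeds the local upper bound u y + 1 of u: s -
   2 is at most 1/b^2 there. *)
pose b : R := `|u y + 1 - M| + 1.
have b0 : 0 < b by rewrite ltr_wpDl.
have c0 : 0 < (b ^+ 2)^-1 by rewrite invr_gt0 exprn_gt0.
have [d2 d20 H2] := continuous_at_dist (geo_continuous (A := A) (a0 := a0) hy) c0.
exists (Num.min d1 d2); first by rewrite lt_min d10.
move=> x Vx; rewrite lt_min => /andP[/H1 + /H2].
rewrite !ler_norml => /andP[_ ux] /andP[_ gx].
have [_ _ gx2] := Vx.
have := scherk_gt0 D (geo A a0 x) (ltW K00).
have : b <= 10 / Num.sqrt (geo A a0 x - 2).
  by apply: inv_sqrt_ge => //; [rewrite subr_gt0|lra].
have : u y + 1 - M <= b - 1 by rewrite /b addrK ler_norm.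
by rewrite /G; lra.
Qed.

(** * Estimates near the boundary at infinity *)

Lemma sqn_eq0 (R : realType) (n : nat) (x : 'rV[R]_n) : eucl_sqnorm x = 0 -> x = 0.
Proof.
move=> /eqP; rewrite psumr_eq0 => [|i _]; last exact: sqr_ge0.
move=> /allP H; apply/rowP => i; rewrite mxE.
by have := H i (mem_index_enum i); rewrite /= sqrf_eq0 => /eqP.
Qed.

Lemma cauchy_schwarz (R : realType) (n : nat) (x y : 'rV[R]_n) :
  dot x y ^+ 2 <= eucl_sqnorm x * eucl_sqnorm y.
Proof.
have [y0|y0] := eqVneq (eucl_sqnorm y) 0.
  rewrite y0 mulr0 (sqn_eq0 y0) -(scale0r 0) dotZr mul0r expr0n /=; exact: lexx.
have yp : 0 < eucl_sqnorm y by rewrite lt0r y0 sqn_ge0.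
rewrite -subr_ge0 -(pmulr_rge0 _ yp).
have -> : eucl_sqnorm y * (eucl_sqnorm x * eucl_sqnorm y - dot x y ^+ 2) =
    eucl_sqnorm (eucl_sqnorm y *: x + (- dot x y) *: y).
  by rewrite [in RHS]sqnE !dotE [dot y x]dotC -!sqnE; ring.
exact: sqn_ge0.
Qed.

Lemma sqnB (R : realType) (n : nat) (x y : 'rV[R]_n) :
  eucl_sqnorm (x - y) = eucl_sqnorm x - 2 * dot x y + eucl_sqnorm y.
Proof. by rewrite !sqnE !dotE [dot y x]dotC; ring. Qed.

Lemma sqnD_le (R : realType) (n : nat) (x y : 'rV[R]_n) :
  eucl_sqnorm (x + y) <= 2 * (eucl_sqnorm x + eucl_sqnorm y).
Proof.
have := sqn_ge0 (x - y); rewrite sqnB.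
have -> : eucl_sqnorm (x + y) = eucl_sqnorm x + 2 * dot x y + eucl_sqnorm y.
  by rewrite !sqnE !dotE [dot y x]dotC; ring.
lra.
Qed.

(** 1 - |y|^2 = (p - y).(p + y), and |p + y| is at most 2. *)
Lemma depth_sqr_le (R : realType) (n : nat) (p y : 'rV[R]_n) :
  eucl_sqnorm p = 1 -> eucl_sqnorm y <= 1 ->
  (1 - eucl_sqnorm y) ^+ 2 <= 4 * eucl_sqnorm (y - p).
Proof.
move=> p1 y1; set w := y - p.
have E : 1 - eucl_sqnorm y = - 2 * dot p w - eucl_sqnorm w.
  by rewrite /w sqnB !dotE -sqnE p1 [dot y p]dotC; ring.
have := cauchy_schwarz p w; rewrite p1 mul1r.
have := sqn_ge0 w.
have : 0 <= 1 - eucl_sqnorm y by rewrite subr_ge0.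
by rewrite E; set a := dot p w; set b := eucl_sqnorm w; nra.
Qed.

(** Since -ln (1 - |x|^2) is the hyperbolic distance to the centre up to a
    bounded error, this is a bound of order 1/r^2. *)
Definition decay (R : realType) (n : nat) (K : R) (x : 'rV[R]_n) : R :=
  K / (1 - ln (1 - eucl_sqnorm x)) ^+ 2.

Lemma depth_ln_le0 (R : realType) (n : nat) (x : 'rV[R]_n) : ln (1 - eucl_sqnorm x) <= 0.
Proof. by apply: ln_le0; rewrite lerBlDr lerDl sqn_ge0. Qed.

Lemma decay_ge0 (R : realType) (n : nat) (K : R) (x : 'rV[R]_n) : 0 <= K -> 0 <= decay K x.
Proof. by move=> K0; rewrite divr_ge0 // sqr_ge0. Qed.

Lemma decay_small (R : realType) (n : nat) (K c : R) (p : 'rV[R]_n) :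
  eucl_sqnorm p = 1 -> 0 < K -> 0 < c -> exists2 d : R, 0 < d &
  forall y, hyp_space R n y -> eucl_sqnorm (y - p) < d ^+ 2 -> decay K y <= c.
Proof.
move=> p1 K0 c0; pose B : R := K / c.
have B0 : 0 < B by rewrite divr_gt0.
exists (expR (- B) / 2); first by rewrite divr_gt0 // expR_gt0.
move=> y hy yp; have qy : 0 < 1 - eucl_sqnorm y by rewrite subr_gt0.
have q2 := depth_sqr_le p1 (ltW hy).
have qB : 1 - eucl_sqnorm y <= expR (- B).
  rewrite -(@ler_pXn2r _ 2) ?nnegrE ?expR_ge0 ?ltW //.
  apply: le_lt_trans q2 _; move: yp; rewrite exprMn; lra.
have lnB : ln (1 - eucl_sqnorm y) <= - B.
  by rewrite -[leRHS]expRK ler_ln ?posrE ?expR_gt0.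
rewrite /decay ler_pdivrMr; last by rewrite exprn_gt0 //; lra.
set t := ln _ in lnB *.
have : 1 + B <= (1 - t) ^+ 2 by nra.
have KB : K = c * B by rewrite /B mulrCA divff ?mulr1 ?gt_eqF.
by move=> H; rewrite KB ler_pM2l //; lra.
Qed.

(** The decay is compared with the right-hand side of the barrier, where t =
    ln s - D: it is enough that |t| exceeds -ln q by a constant at most. *)
Lemma decay_le_tau (R : realType) (n : nat) (K t : R) (y : 'rV[R]_n) :
  0 < K -> t <= 5 - ln (1 - eucl_sqnorm y) -> - (5 - ln (1 - eucl_sqnorm y)) <= t ->
  decay K y <= 29 * K / (4 + t ^+ 2).
Proof.
move=> K0 t1 t2; have l0 := depth_ln_le0 y.
rewrite /decay; set l := ln _ in t1 t2 l0 *.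
have l1 : 0 < (1 - l) ^+ 2 by rewrite exprn_gt0 //; lra.
have t4 := sqr4_gt0 t.
rewrite ler_pdivrMr // mulrAC ler_pdivlMr // [29 * K]mulrC -mulrA ler_pM2l //.
have : t ^+ 2 <= (5 - l) ^+ 2 by nra.
by move=> H; nra.
Qed.

Lemma within_continuous_dist (R : realType) (V : normedModType R) (E : set V) (u : V -> R) (y : V) (e : R) :
  {within E, continuous u} -> E y -> 0 < e ->
  exists2 d : R, 0 < d & forall x, E x -> `|x - y| < d -> `|u x - u y| <= e.
Proof.
move=> /subspace_continuousP cu Ey e0.
have /cvgrPdist_le /(_ _ e0) := cu y Ey.
move=> /nbhs_ballP[d /= d0 Hd]; exists d => // x Ex xy.
rewrite distrC; apply: Hd => //.
by rewrite -ball_normE /= distrC.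
Qed.

Lemma closure_ge0 (R : realType) (V : normedModType R) (E : set V) (f : V -> R) (y : V) :
  {for y, continuous f} -> (forall x, E x -> 0 <= f x) -> closure E y -> 0 <= f y.
Proof.
move=> cf f0 Ey; rewrite leNgt; apply/negP => fy.
have h0 : 0 < - f y / 2 by rewrite divr_gt0 // oppr_gt0.
have [d d0 Hd] := continuous_at_dist cf h0.
have [x Ex xy] := closure_dist Ey d0.
by have := Hd x xy; rewrite ler_norml => /andP[_]; have := f0 x Ex; lra.
Qed.

Lemma sqnB_continuous (R : realType) (n : nat) (p y : 'rV[R]_n) :
  {for y, continuous (fun x : 'rV[R]_n => eucl_sqnorm (x - p))}.
Proof.
have -> : (fun x : 'rV[R]_n => eucl_sqnorm (x - p)) = (fun x => eucl_sqnorm x - 2 * dot p x + eucl_sqnorm p).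
  by apply/funext => x; rewrite sqnB dotC.
apply: cts_add; last exact: cts_cst.
apply: cts_sub; first exact: sqn_continuous.
by apply: cts_mul; [exact: cts_cst|exact: dot_continuous].
Qed.

Lemma open_disc (R : realType) (n : nat) (p : 'rV[R]_n) (r : R) :
  open [set y : 'rV[R]_n | eucl_sqnorm (y - p) < r].
Proof.
apply: (@open_comp _ _ (fun x : 'rV[R]_n => eucl_sqnorm (x - p)) [set z | z < r]).
  by move=> x _; exact: sqnB_continuous.
exact: open_lt.
Qed.

(** * Boundedness near a puncture *)

Definition punctured (R : realType) (n : nat) (p : 'rV[R]_n) (d : R) : set 'rV[R]_n :=
  [set y | eucl_sqnorm y <= 1 /\ 0 < eucl_sqnorm (y - p) <= d ^+ 2].

Lemma ball_neq_boundary (R : realType) (n : nat) (p x : 'rV[R]_n) :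
  eucl_sqnorm p = 1 -> hyp_space R n x -> 0 < eucl_sqnorm (x - p).
Proof.
move=> p1 hx; rewrite lt0r sqn_ge0 andbT; apply/eqP => /sqn_eq0 /eqP.
by rewrite subr_eq0 => /eqP xp; move: hx; rewrite /hyp_space /= xp p1 ltxx.
Qed.

(** When r^2 = 2 th - th^2, these are the totally geodesic hyperplanes
    orthogonal to the diameter through p; the half-space s > 0 is the side
    that does not contain p in its closure, and it fills the ball as th
    tends to 0. *)
Lemma geo_toward (R : realType) (n : nat) (p y : 'rV[R]_n) (th r : R) :
  eucl_sqnorm p = 1 -> 0 < r -> hyp_space R n y ->
  geo (- r^-1 *: p) (- (1 - th) / r) y * r * (1 - eucl_sqnorm y) =
    eucl_sqnorm (y - p) - th * (1 + eucl_sqnorm y).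
Proof.
move=> p1 r0 /hyp_spaceN0 q0; rewrite /geo sqnB dotZl p1 [dot y p]dotC.
by field; rewrite ?q0 ?gt_eqF.
Qed.

(** The identity s r q = |y - p|^2 - th (1 + |y|^2) bounds s r by a constant
    over q. As s is at least 2 and r^2 is comparable to th, th is at most a
    multiple of (s r)^2; with q^2 <= 4 |y - p|^2 the same identity then
    bounds s r below by a multiple of q. *)
Lemma geo_toward_tau (R : realType) (n : nat) (p y : 'rV[R]_n) (th r s : R) :
  eucl_sqnorm p = 1 -> 0 < r -> hyp_space R n y -> 0 < th -> th <= 1 ->
  r ^+ 2 = 2 * th - th ^+ 2 -> s = geo (- r^-1 *: p) (- (1 - th) / r) y -> 2 < s ->
  let l := ln (1 - eucl_sqnorm y) in
  ln s - (- ln r) <= 5 - l /\ - (5 - l) <= ln s - (- ln r).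
Proof.
move=> p1 r0 hy th0 th1 rE sE s2.
have qy : 0 < 1 - eucl_sqnorm y by rewrite subr_gt0.
have sg := geo_toward th p1 r0 hy; rewrite -sE in sg.
have s0 : 0 < s by lra.
have sr0 : 0 < s * r by rewrite mulr_gt0.
have y0 := sqn_ge0 y.
have q2 := depth_sqr_le p1 (ltW hy).
have yp4 : eucl_sqnorm (y - p) <= 4.
  apply: le_trans (sqnD_le _ _) _; have : eucl_sqnorm (- p) = 1 by rewrite sqnE dotNl dotNr opprK -sqnE.
  by move=> ->; move: hy; rewrite /hyp_space /=; lra.
move=> l; rewrite opprK -lnM ?posrE //.
move: q2 sg qy; rewrite /l; set q : R := 1 - eucl_sqnorm y => q2 sg qy.
set m := s * r in sr0 sg *.
have tq : 0 < th * (1 + eucl_sqnorm y) by rewrite mulr_gt0 //; lra.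
have mq4 : m * q <= 4 by rewrite sg; lra.
have m2 : 4 * th <= m ^+ 2.
  rewrite /m exprMn rE.
  have : 4 <= s ^+ 2 by nra.
  have : th <= 2 * th - th ^+ 2 by nra.
  by nra.
have q6 : q <= 6 * m.
  rewrite leNgt; apply/negP => mq.
  have : th * (1 + eucl_sqnorm y) <= 2 * th by move: hy; rewrite /hyp_space /=; nra.
  by nra.
split.
  have : ln (m * q) <= 4 - 1.
    apply: le_trans (_ : ln (1 + 3) <= _); last by apply: le_trans (le_ln1Dx _) _; lra.
    by rewrite ler_ln ?posrE ?mulr_gt0 //; lra.
  by rewrite lnM ?posrE //; lra.
have : ln q <= 5 + ln m.
  apply: le_trans (_ : ln ((1 + 5) * m) <= _).
    by rewrite ler_ln ?posrE ?mulr_gt0 //; lra.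
  rewrite lnM ?posrE // lerD2r; apply: le_ln1Dx; lra.
lra.
Qed.

Lemma scherk_le (R : realType) (K0 D s : R) : 0 <= K0 -> 3 <= s -> scherk K0 D s <= 10 + 17 * K0 * pi.
Proof.
move=> K00 s3; rewrite /scherk lerD //.
  rewrite ler_pdivrMr ?sqrtr_gt0 ?subr_gt0; last by lra.
  have : Num.sqrt 1 <= Num.sqrt (s - 2) by apply: ler_wsqrtr; lra.
  by rewrite sqrtr1; lra.
rewrite ler_wpM2l ?mulr_ge0 //.
by have := atan_gtNpi2 ((ln s - D) / 2); lra.
Qed.

(** The barrier over the half-space attached to x is bounded at x by a
    constant which does not depend on x, since the half-space can be chosen
    with s >= 3 at x. Its hypersurface s = 2 hides the puncture, where
    nothing is known; on the rest of the boundary u is controlled by its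
    maximum on a compact cap around p and by its values at infinity. *)
Lemma bounded_above_near_puncture (R : realType) (n : nat) (u : 'rV[R]_n -> R) (p : 'rV[R]_n) (K L d0 : R) :
  (2 <= n)%N -> 0 < K -> eucl_sqnorm p = 1 -> Ck 2 (hyp_space R n) u ->
  (forall x, hyp_space R n x -> - hyp_mean_curvature u x <= decay K x) ->
  0 < d0 -> {within punctured p d0, continuous u} ->
  (forall e, 0 < e -> exists2 d : R, 0 < d & forall y, eucl_sqnorm y = 1 ->
     0 < eucl_sqnorm (y - p) < d ^+ 2 -> u y <= L + e) ->
  exists M : R, exists2 d : R, 0 < d & forall x, hyp_space R n x ->
    eucl_sqnorm (x - p) < d ^+ 2 -> u x <= M.
Proof.
move=> n2 K0 p1 uC2 uF d00 uE ub.
(* The barrier needs a decay of at most 1/16. *)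
have c16 : 0 < 1 / 16 :> R by lra.
have [d1 d10 H1] := decay_small p1 K0 c16.
have [d2 d20 H2] := ub 1 ltr01.
pose m : R := Num.min d0 (Num.min d1 d2).
have m0 : 0 < m by rewrite !lt_min d00 d10.
have [md0 md1 md2] : [/\ m <= d0, m <= d1 & m <= d2] by rewrite /m !ge_min !lexx !orbT.
pose d : R := m / 2.
have dp : 0 < d by rewrite divr_gt0.
have dm : d < m by rewrite /d; lra.
have sqlt (a b : R) : 0 < a -> a < b -> a ^+ 2 < b ^+ 2 by move=> ? ?; nra.
have dd0 : d ^+ 2 < d0 ^+ 2 by apply: sqlt => //; lra.
have dd1 : d ^+ 2 < d1 ^+ 2 by apply: sqlt => //; lra.
have dd2 : d ^+ 2 < d2 ^+ 2 by apply: sqlt => //; lra.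
pose C : set 'rV[R]_n := [set y | eucl_sqnorm y <= 1 /\ eucl_sqnorm (y - p) = d ^+ 2].
have CE : C `<=` punctured p d0.
  by move=> y [y1 yd]; split=> //; rewrite yd exprn_gt0 //= ltW.
have [M0 HM0] : exists M0 : R, forall y, C y -> u y <= M0.
  have [[y0 Cy0]|nC] := pselect (exists y, C y); last first.
    by exists 0 => y Cy; exfalso; apply: nC; exists y.
  have cC : compact C.
    apply: bounded_closed_compact.
      exists 1; split=> // M1 M11 x [x1 _] /=.
      apply/ltW/norm_lt_sqn; first by lra.
      by apply: le_lt_trans x1 _; nra.
    have -> : C = (@eucl_sqnorm R n @^-1` [set z | z <= 1]) `&`
        ((fun x : 'rV[R]_n => eucl_sqnorm (x - p)) @^-1` [set z | z = d ^+ 2]) by [].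
    apply: closedI; apply: preimage_closed.
    - by move=> x _; exact: sqn_continuous.
    - exact: closed_le.
    - by move=> x _; exact: sqnB_continuous.
    - exact: closed_eq.
  have [c _ Hc] : exists2 c, c \in C & forall t, t \in C -> u t <= u c.
    apply: EVT_max_rV => //; first by exists y0.
    exact: continuous_subspaceW CE uE.
  by exists (u c) => y Cy; apply: Hc; rewrite inE.
pose M : R := Num.max M0 (L + 1).
have [MM0 ML] : M0 <= M /\ L + 1 <= M by rewrite /M !le_max !lexx orbT.
exists (M + (10 + 17 * (29 * K) * pi)); exists d => // x hx xd.
have m1 : 0 < eucl_sqnorm (x - p) by exact: ball_neq_boundary.
set mm := eucl_sqnorm (x - p) in m1 xd.
have mm4 : mm <= 4.
  apply: le_trans (sqnD_le _ _) _; have : eucl_sqnorm (- p) = 1 by rewrite sqnE dotNl dotNr opprK -sqnE.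
  by move=> ->; move: hx; rewrite /hyp_space /=; lra.
(* The choice th = |x - p|^4/128 makes r at most |x - p|^2/8, so that
   s >= 3 at x. *)
pose th : R := mm ^+ 2 / 128.
have th0 : 0 < th by rewrite divr_gt0 // exprn_gt0.
have th1 : th <= 1 / 8 by rewrite /th; nra.
pose r : R := Num.sqrt (2 * th - th ^+ 2).
have k0 : 0 < 2 * th - th ^+ 2 by nra.
have r0 : 0 < r by rewrite sqrtr_gt0.
have rr : r ^+ 2 = 2 * th - th ^+ 2 by rewrite sqr_sqrtr // ltW.
have r8 : r <= mm / 8.
  rewrite -(@ler_pXn2r _ 2) ?nnegrE ?ltW ?divr_gt0 // rr /th.
  by have := exprn_gt0 2 th0; rewrite /th; set m2 := mm ^+ 2 / 128; have -> : (mm / 8) ^+ 2 = 2 * m2; [rewrite /m2; field|lra].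
pose A : 'rV[R]_n := - r^-1 *: p.
pose a0 : R := - (1 - th) / r.
have A1 : eucl_sqnorm A - a0 ^+ 2 = 1.
  rewrite /A /a0 sqnE dotZl dotZr -sqnE p1.
  have -> : - r^-1 * (- r^-1 * 1) - (- (1 - th) / r) ^+ 2 = (2 * th - th ^+ 2) / r ^+ 2.
    by field; rewrite gt_eqF.
  by rewrite -rr divff // gt_eqF // exprn_gt0.
pose O : set 'rV[R]_n := [set y | eucl_sqnorm (y - p) < d ^+ 2].
have K29 : 0 < 29 * K by rewrite mulr_gt0.
have sx : 3 <= geo A a0 x.
  have := geo_toward th p1 r0 hx; rewrite -/A -/a0 -/mm => E.
  have x1 : eucl_sqnorm x < 1 by [].
  have x0 := sqn_ge0 x.
  rewrite leNgt; apply/negP => s3.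
  have rq : 0 < r * (1 - eucl_sqnorm x) by rewrite mulr_gt0 // subr_gt0.
  have rq8 : r * (1 - eucl_sqnorm x) <= mm / 8 by nra.
  have : geo A a0 x * r * (1 - eucl_sqnorm x) < 3 * (r * (1 - eucl_sqnorm x)).
    by rewrite -mulrA ltr_pM2r.
  rewrite E; have : th * (1 + eucl_sqnorm x) <= 2 * th by nra.
  by rewrite /th; nra.
apply: (@le_trans _ _ (M + scherk (29 * K) (- ln r) (geo A a0 x))); last first.
  by rewrite lerD2l; apply: scherk_le => //; exact: ltW.
have SB := @scherk_bound R n u (decay K) A a0 O (29 * K) (- ln r) M n2 A1 K29 uC2
  (@open_disc R n p (d ^+ 2)) uF.
apply: SB; last by split=> //; lra.
  move=> y [hy Oy s2]; split; first by apply: decay_ge0; exact: ltW.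
    by apply: H1 => //; exact: lt_trans Oy dd1.
  have [t1 t2] := geo_toward_tau p1 r0 hy th0 ltac:(lra) rr erefl s2.
  by apply: decay_le_tau.
move=> y e cVy nVy e0.
have VE z : [/\ hyp_space R n z, O z & 2 < geo A a0 z] -> punctured p d0 z.
  move=> [hz Oz _]; split; first exact: ltW.
  by rewrite ball_neq_boundary //= ltW // (lt_trans Oz).
have y1 : 0 <= 1 - eucl_sqnorm y.
  apply: (closure_ge0 (f := fun z : 'rV[R]_n => 1 - eucl_sqnorm z) _ _ cVy); first by apply: cts_sub; [exact: cts_cst|exact: sqn_continuous].
  by move=> z [hz _ _]; rewrite subr_ge0 ltW.
have yd : 0 <= d ^+ 2 - eucl_sqnorm (y - p).
  apply: (closure_ge0 (f := fun z : 'rV[R]_n => d ^+ 2 - eucl_sqnorm (z - p)) _ _ cVy); first by apply: cts_sub; [exact: cts_cst|exact: sqnB_continuous].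
  by move=> z [_ Oz _]; rewrite subr_ge0 ltW.
(* This keeps the puncture out of the closure of the region. *)
have yth : 0 <= eucl_sqnorm (y - p) - th * (1 + eucl_sqnorm y).
  apply: (closure_ge0 (f := fun z : 'rV[R]_n => eucl_sqnorm (z - p) - th * (1 + eucl_sqnorm z)) _ _ cVy).
    apply: cts_sub; first exact: sqnB_continuous.
    apply: cts_mul; first exact: cts_cst.
    by apply: cts_add; [exact: cts_cst|exact: sqn_continuous].
  move=> z [hz _ s2]; have := geo_toward th p1 r0 hz; rewrite -/A -/a0 => <-.
  have z1 : 0 <= 1 - eucl_sqnorm z by rewrite subr_ge0 ltW.
  by rewrite mulr_ge0 // mulr_ge0 ?(ltW r0) //; lra.
have yp : 0 < eucl_sqnorm (y - p).
  have H : 0 <= th * eucl_sqnorm y by rewrite mulr_ge0 ?sqn_ge0 // ltW.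
  by have := sqn_ge0 y; lra.
have Ey : punctured p d0 y by split; [lra|rewrite yp /=; lra].
have uy : u y <= M.
  have [y1'|y1'] := ltP (eucl_sqnorm y) 1.
    apply: le_trans MM0; apply: HM0; split; first exact: ltW.
    apply/eqP; rewrite eq_le leNgt; apply/andP; split; last first.
      by rewrite leNgt; apply/negP => yO; apply: nVy.
    by rewrite -leNgt; lra.
  apply: le_trans ML; apply: H2; first by lra.
  by rewrite yp /=; lra.
have e2 : 0 < e / 2 by rewrite divr_gt0.
have [dd ddp Hd] := within_continuous_dist uE Ey e2.
exists dd => // z /VE Ez /(Hd _ Ez); rewrite ler_norml => /andP[_]; lra.
Qed.

(** * Half-spaces that come close to a puncture but avoid it *)

Lemma unit_orthogonal (R : realType) (n : nat) (p : 'rV[R]_n) :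
  (2 <= n)%N -> eucl_sqnorm p = 1 ->
  exists2 e : 'rV[R]_n, eucl_sqnorm e = 1 & dot p e = 0.
Proof.
move=> n2 p1.
have [i pi0] : exists i, p 0 i != 0.
  apply: contrapT => H; have p0 : p = 0.
    apply/rowP => i; rewrite mxE; apply/eqP; apply: contrapT => /negP pi0.
    by apply: H; exists i.
  by move: p1; rewrite p0 sqnE -(scale0r 0) dotZl mul0r => /esym/eqP; rewrite oner_eq0.
have [j ij] : exists j : 'I_n, i != j.
  have := n2; rewrite -{1}(card_ord n) (cardD1 i) inE /= add1n ltnS => /card_gt0P[j].
  by rewrite !inE andbT eq_sym => ij; exists j.
pose e0 : 'rV[R]_n := p 0 j *: delta_mx 0 i + (- p 0 i) *: delta_mx 0 j.
have e00 : 0 < eucl_sqnorm e0.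
  rewrite /e0 sqn_delta_comb (negbTE ij) mulr0 addr0 sqrrN ltr_wpDl ?sqr_ge0 //.
  by rewrite lt0r sqrf_eq0 pi0 sqr_ge0.
exists ((Num.sqrt (eucl_sqnorm e0))^-1 *: e0).
  rewrite sqnE dotZl dotZr -sqnE -[X in _ * (_ * X)]sqr_sqrtr ?(ltW e00) //.
  by field; rewrite gt_eqF // sqrtr_gt0.
by rewrite dotZr /e0 !dotE !dot_delta; ring.
Qed.

(** The normalized component of x orthogonal to p; when x is a multiple of
    p, any unit vector orthogonal to p, which exists since the dimension is
    at least 2. *)
Lemma tangent_direction (R : realType) (n : nat) (p x : 'rV[R]_n) :
  (2 <= n)%N -> eucl_sqnorm p = 1 ->
  exists e : 'rV[R]_n, [/\ eucl_sqnorm e = 1, dot p e = 0, 0 <= dot x e &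
    dot x e ^+ 2 = eucl_sqnorm x - dot x p ^+ 2].
Proof.
move=> n2 p1; pose w := x + (- dot x p) *: p.
have wE : eucl_sqnorm w = eucl_sqnorm x - dot x p ^+ 2.
  by rewrite /w sqnE !dotE [dot p x]dotC -!sqnE p1; ring.
have pw : dot p w = 0 by rewrite /w !dotE -sqnE p1 [dot p x]dotC; ring.
have xw : dot x w = eucl_sqnorm w by rewrite wE /w !dotE -sqnE; ring.
have [w0|w0] := eqVneq (eucl_sqnorm w) 0.
  have [e e1 pe] := unit_orthogonal n2 p1.
  have xp : x = dot x p *: p.
    by move: (sqn_eq0 w0); rewrite /w scaleNr => /eqP; rewrite subr_eq0 => /eqP.
  have xe : dot x e = 0 by rewrite xp dotZl pe mulr0.
  by exists e; split=> //; rewrite xe // -wE w0 expr0n.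
have wp : 0 < eucl_sqnorm w by rewrite lt0r w0 sqn_ge0.
have r0 : 0 < Num.sqrt (eucl_sqnorm w) by rewrite sqrtr_gt0.
have rr : Num.sqrt (eucl_sqnorm w) ^+ 2 = eucl_sqnorm w by rewrite sqr_sqrtr // ltW.
set r := Num.sqrt _ in r0 rr.
exists (r^-1 *: w); split.
- by rewrite sqnE dotZl dotZr -sqnE -rr; field; rewrite gt_eqF.
- by rewrite dotZr pw mulr0.
- by rewrite dotZr xw mulr_ge0 ?invr_ge0 ?ltW.
- by rewrite dotZr xw -wE -rr; field; rewrite gt_eqF.
Qed.

(** When |xi|^2 = 1 + r^2 the right-hand side is r^2 - |y - xi|^2: the
    half-space s > 0 is the part of the ball inside the sphere of centre xi
    and radius r, which is orthogonal to the unit sphere. *)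
Lemma geo_sphere (R : realType) (n : nat) (xi y : 'rV[R]_n) (r : R) :
  0 < r -> hyp_space R n y ->
  geo (r^-1 *: xi) r^-1 y * r * (1 - eucl_sqnorm y) = 2 * dot xi y - (1 + eucl_sqnorm y).
Proof.
move=> r0 /hyp_spaceN0 q0; rewrite /geo dotZl.
by field; rewrite ?q0 ?gt_eqF.
Qed.

(** The puncture must not be in the closure of the half-space, which
    excludes centring it on the ray of p; and x may approach p from any
    direction, even tangentially. Moving the centre by eta = |x - p| in the
    direction of x, and inwards by a small t, keeps p outside, since xi.p =
    1 - t, and keeps x within a bounded distance of the half-space. *)
Lemma lens_halfspace (R : realType) (n : nat) (p x : 'rV[R]_n) (eta : R) :
  (2 <= n)%N -> eucl_sqnorm p = 1 -> hyp_space R n x ->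
  0 < eta -> eta <= 1 / 2 -> eta ^+ 2 = eucl_sqnorm (x - p) ->
  exists xi : 'rV[R]_n, exists r : R,
  [/\ [/\ 0 < r, r <= eta & eucl_sqnorm xi = 1 + r ^+ 2], dot xi p < 1,
      -2 <= geo (r^-1 *: xi) r^-1 x,
      (forall y, hyp_space R n y -> -3 <= geo (r^-1 *: xi) r^-1 y ->
         eucl_sqnorm (y - p) < 144 * eta ^+ 2) &
      (forall y, hyp_space R n y ->
         geo (r^-1 *: xi) r^-1 y * (1 - eucl_sqnorm y) <= r)].
Proof.
move=> n2 p1 hx eta0 eta1 etaE.
have [e [e1 pe xe0 xe2]] := tangent_direction x n2 p1.
(* Every small positive t keeps p outside the sphere; the order eta^2
   keeps r comparable to eta and s >= -2 at x. *)
pose t : R := eta ^+ 2 / 4.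
have [xi xidef] : exists xi : 'rV[R]_n, xi = (1 - t) *: p + eta *: e by eexists.
have e2 : 0 < eta ^+ 2 by rewrite exprn_gt0.
have rho0 : 0 < t ^+ 2 - 2 * t + eta ^+ 2.
  by rewrite /t; have := sqr_ge0 (eta ^+ 2 / 4); lra.
pose r : R := Num.sqrt (t ^+ 2 - 2 * t + eta ^+ 2).
have r0 : 0 < r by rewrite sqrtr_gt0.
have rr : r ^+ 2 = t ^+ 2 - 2 * t + eta ^+ 2 by rewrite sqr_sqrtr // ltW.
have t4 : eta ^+ 2 = 4 * t by rewrite /t; field.
have t1 : t <= 1 / 16 by rewrite /t; nra.
have t0 : 0 < t by rewrite /t; lra.
have re : r <= eta.
  by rewrite -(@ler_pXn2r _ 2) ?nnegrE ?ltW // rr; nra.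
have er : eta / 2 <= r.
  rewrite -(@ler_pXn2r _ 2) ?nnegrE ?ltW ?divr_gt0 // rr.
  have -> : (eta / 2) ^+ 2 = t by rewrite /t; field.
  by rewrite t4; nra.
have xiE : eucl_sqnorm xi = 1 + r ^+ 2.
  by rewrite rr xidef sqnE !dotE [dot e p]dotC pe -!sqnE p1 e1; ring.
have xip : dot xi p = 1 - t by rewrite xidef !dotE [dot e p]dotC pe -sqnE p1; ring.
exists xi, r; split => //.
- by rewrite xip; lra.
- have q0 : 0 < 1 - eucl_sqnorm x by rewrite subr_gt0.
  have G := geo_sphere xi r0 hx.
  suff : -2 * (r * (1 - eucl_sqnorm x)) <= geo (r^-1 *: xi) r^-1 x * (r * (1 - eucl_sqnorm x)).
    by rewrite ler_pM2r // mulr_gt0.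
  rewrite [leRHS]mulrA G.
  have xxi : dot xi x = (1 - t) * dot x p + eta * dot x e.
    by rewrite xidef !dotE [dot e x]dotC [dot p x]dotC.
  rewrite xxi.
  have vE : eta ^+ 2 = eucl_sqnorm x - 2 * dot x p + 1 by rewrite etaE sqnB p1.
  move: xe0 xe2 vE q0; set v := dot x p; set tau := dot x e; set X := eucl_sqnorm x.
  move=> tau0 tau2 vE q0.
  have v1 : v <= 1 by nra.
  have tm : eta <= tau + (1 - v).
    rewrite -(@ler_pXn2r _ 2) ?nnegrE ?(ltW eta0) //; last by lra.
    have : 0 <= tau * (1 - v) by rewrite mulr_ge0 // subr_ge0.
    by nra.
  have rq : eta / 2 * (1 - X) <= r * (1 - X) by rewrite ler_pM2r.
  have XE : X = eta ^+ 2 + 2 * v - 1 by lra.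
  have tv : t * v <= t by rewrite ler_piMr // ltW.
  have H1 := ler_wpM2l (ltW eta0) tm.
  have H2 : eta * eta ^+ 2 <= 1 / 2 * eta ^+ 2 by rewrite ler_pM2r.
  move: rq; rewrite XE => rq; nra.
- move=> y hy s3.
  have q0 : 0 < 1 - eucl_sqnorm y by rewrite subr_gt0.
  have G := geo_sphere xi r0 hy.
  have : -3 * (r * (1 - eucl_sqnorm y)) <= geo (r^-1 *: xi) r^-1 y * (r * (1 - eucl_sqnorm y)).
    by rewrite ler_pM2r // mulr_gt0.
  rewrite [leRHS]mulrA G => H.
  have mE : eucl_sqnorm (y - xi) = eucl_sqnorm y - 2 * dot xi y + (1 + r ^+ 2).
    by rewrite sqnB xiE [dot y xi]dotC.
  (* 1 + r^2 - |y|^2 = (xi - y).(xi + y) bounds 1 - |y|^2 by a multiple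
     of |y - xi|. Together with s >= -3, which bounds |y - xi|^2 by r^2
     + 3 r (1 - |y|^2), this gives |y - xi| of order r. *)
  have C := cauchy_schwarz (xi - y) (xi + y).
  have CE : dot (xi - y) (xi + y) = 1 + r ^+ 2 - eucl_sqnorm y.
    by rewrite !dotE [dot y xi]dotC -!sqnE xiE; ring.
  rewrite CE in C.
  have mC : eucl_sqnorm (xi - y) = eucl_sqnorm (y - xi) by rewrite !sqnB [dot y xi]dotC; ring.
  rewrite mC in C.
  have S := sqnD_le xi y; rewrite xiE in S.
  have m0 := sqn_ge0 (y - xi).
  have y0 := sqn_ge0 y.
  have r2 : r ^+ 2 <= 1 / 4 by nra.
  have S6 : eucl_sqnorm (xi + y) <= 6 by lra.
  have pxi : eucl_sqnorm (xi - p) <= 2 * eta ^+ 2.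
    have -> : xi - p = (- t) *: p + eta *: e.
      by apply/rowP => i; rewrite xidef !mxE; ring.
    by rewrite sqnE !dotE [dot e p]dotC pe -!sqnE p1 e1; nra.
  have T := sqnD_le (y - xi) (xi - p).
  rewrite addrA subrK in T.
  move: C H mE q0 T m0 S6; set m := eucl_sqnorm (y - xi); set Y := eucl_sqnorm y.
  move=> C H mE q0 T m0 S6.
  have mb : m <= r ^+ 2 + 3 * (r * (1 - Y)) by lra.
  have C6 : (1 - Y) ^+ 2 <= 6 * m.
    apply: (@le_trans _ _ ((1 + r ^+ 2 - Y) ^+ 2)); first by have := sqr_ge0 r; nra.
    by apply: le_trans C _; rewrite mulrC ler_wpM2r.
  have q19 : 1 - Y <= 19 * r by rewrite leNgt; apply/negP => q19; nra.
  have m58 : m <= 58 * r ^+ 2 by nra.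
  have : r ^+ 2 <= eta ^+ 2 by nra.
  lra.
- move=> y hy; have G := geo_sphere xi r0 hy.
  have := sqn_ge0 (y - xi); rewrite sqnB xiE [dot y xi]dotC => H.
  rewrite -(ler_pM2r r0) mulrAC G; lra.
Qed.

(** * Lowering an upper bound near a puncture *)

Lemma atan_near_pihalf (R : realType) (e : R) : 0 < e ->
  exists2 T : R, 0 < T & forall t : R, T <= t -> pi / 2 - atan t <= e.
Proof.
move=> e0; pose e' : R := Num.min e 1.
have e'0 : 0 < e' by rewrite lt_min e0 ltr01.
have [e'e e'1] : e' <= e /\ e' <= 1 by rewrite !ge_min !lexx orbT.
pose y : R := tan (pi / 2 - e').
have p1 := pihalf_ge1 R.
have ay : atan y = pi / 2 - e'.
  by rewrite tanK // in_itv /=; apply/andP; split; lra.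
exists (Num.max y 1); first by rewrite lt_max ltr01 orbT.
move=> t; rewrite ge_max => /andP[yt _].
have : atan y <= atan t.
  by move: yt; rewrite le_eqVlt => /orP[/eqP -> //|/lt_atan /ltW].
by rewrite ay; lra.
Qed.

(** Far inside the half-space the square-root term is small; if moreover D
    is very negative, that is if the half-space is close to infinity, the
    arctangent term is small as well. *)
Lemma scherk_tail (R : realType) (K0 c : R) : 0 < K0 -> 0 < c ->
  exists S : R, exists T : R, [/\ 3 < S, 0 < T & forall s D : R, S - 1 <= s -> D <= - (2 * T) ->
    scherk K0 D s <= c].
Proof.
move=> K00 c0; have c2 : 0 < c / 2 by rewrite divr_gt0.
have e0 : 0 < c / 2 / (17 * K0) by rewrite divr_gt0 // mulr_gt0.
have [T T0 HT] := atan_near_pihalf e0.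
have b0 : 0 < 20 / c by rewrite divr_gt0.
(* For s - 2 at least (20/c)^2 the square-root term is at most c/2. *)
exists (3 + (20 / c) ^+ 2), T; split=> //.
  by rewrite ltrDl exprn_gt0.
move=> s D sS DT; rewrite /scherk [leRHS](_ : c = c / 2 + c / 2); last by field.
have b2 : 0 < (20 / c) ^+ 2 by rewrite exprn_gt0.
have s2 : 0 < s - 2 by lra.
apply: lerD.
  rewrite ler_pdivrMr ?sqrtr_gt0 // -ler_pdivrMl //.
  have -> : (c / 2)^-1 * 10 = Num.sqrt ((20 / c) ^+ 2).
    by rewrite sqrtr_sqr ger0_norm ?ltW //; field; rewrite gt_eqF.
  by apply: ler_wsqrtr; lra.
have ls : 0 <= ln s by apply: ln_ge0; lra.
rewrite -ler_pdivlMl ?mulr_gt0 // [(17 * K0)^-1 * _]mulrC; apply: HT; lra.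
Qed.

Lemma open_slab (R : realType) (n : nat) (A : 'rV[R]_n) (a0 s1 s2 : R) :
  open [set y | hyp_space R n y /\ s1 < geo A a0 y < s2].
Proof.
rewrite openE => y [hy /andP[y1 y2]].
have [d d0 Hd] := open_dist (@hyp_space_open R n) hy.
have gc := geo_continuous (A := A) (a0 := a0) hy.
have h1 : 0 < (geo A a0 y - s1) / 2 by rewrite divr_gt0 // subr_gt0.
have h2 : 0 < (s2 - geo A a0 y) / 2 by rewrite divr_gt0 // subr_gt0.
have [e1 e10 H1] := continuous_at_dist gc h1.
have [e2 e20 H2] := continuous_at_dist gc h2.
apply/nbhs_ballP; exists (Num.min d (Num.min e1 e2)); first by rewrite /= !lt_min d0 e10.
move=> z; rewrite -ball_normE /= distrC !lt_min => /and3P[/Hd hz /H1 z1 /H2 z2].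
split=> //; move: z1 z2; rewrite !ler_norml => /andP[z1 _] /andP[_ z2].
clear - h1 h2 z1 z2; by apply/andP; split; lra.
Qed.

(** Equidistant hypersurfaces have the same points at infinity: those of the
    set s >= -3 satisfy xi.y >= 1, so p is not one of them and u is
    continuous there with values at most C. *)
Lemma lens_at_infinity (R : realType) (n : nat) (u : 'rV[R]_n -> R) (p xi : 'rV[R]_n)
    (r rho d0 C c : R) (V : set 'rV[R]_n) (y : 'rV[R]_n) :
  eucl_sqnorm p = 1 -> 0 < c -> {within punctured p d0, continuous u} ->
  (forall z, eucl_sqnorm z = 1 -> 0 < eucl_sqnorm (z - p) <= rho -> u z <= C) ->
  0 < r -> dot xi p < 1 -> rho <= d0 ^+ 2 ->
  (forall z, hyp_space R n z -> -3 <= geo (r^-1 *: xi) r^-1 z -> eucl_sqnorm (z - p) <= rho) ->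
  (forall z, V z -> hyp_space R n z /\ -3 <= geo (r^-1 *: xi) r^-1 z) ->
  closure V y -> ~ hyp_space R n y ->
  exists2 d : R, 0 < d & forall z, V z -> `|z - y| < d -> u z <= C + c.
Proof.
move=> p1 c0 uE ub r0 xip rhod Hlens VV cVy nhy.
have y1 : 0 <= 1 - eucl_sqnorm y.
  apply: (closure_ge0 (f := fun z : 'rV[R]_n => 1 - eucl_sqnorm z) _ _ cVy).
    by apply: cts_sub; [exact: cts_cst|exact: sqn_continuous].
  by move=> z /VV[hz _]; rewrite subr_ge0 ltW.
have y1' : eucl_sqnorm y = 1.
  by apply/eqP; rewrite eq_le -subr_ge0 y1 leNgt; apply/negP.
have yrho : 0 <= rho - eucl_sqnorm (y - p).
  apply: (closure_ge0 (f := fun z : 'rV[R]_n => rho - eucl_sqnorm (z - p)) _ _ cVy).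
    by apply: cts_sub; [exact: cts_cst|exact: sqnB_continuous].
  by move=> z /VV[hz sz]; rewrite subr_ge0; exact: Hlens.
have yxi : 0 <= 2 * dot xi y - (1 + eucl_sqnorm y) + 3 * r * (1 - eucl_sqnorm y).
  apply: (closure_ge0 (f := fun z : 'rV[R]_n => 2 * dot xi z - (1 + eucl_sqnorm z)
      + 3 * r * (1 - eucl_sqnorm z)) _ _ cVy).
    have cs := @sqn_continuous R n y.
    apply: cts_add.
      apply: cts_sub; first by apply: cts_mul; [exact: cts_cst|exact: dot_continuous].
      by apply: cts_add; [exact: cts_cst|exact: cs].
    by apply: cts_mul; [exact: cts_cst|apply: cts_sub; [exact: cts_cst|exact: cs]].
  move=> z /VV[hz sz]; rewrite -(geo_sphere xi r0 hz).
  have rq : 0 < r * (1 - eucl_sqnorm z) by rewrite mulr_gt0 // subr_gt0.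
  move: sz; set g := geo _ _ z => sz.
  have -> : g * r * (1 - eucl_sqnorm z) + 3 * r * (1 - eucl_sqnorm z) =
    (g + 3) * (r * (1 - eucl_sqnorm z)) by ring.
  by rewrite mulr_ge0 ?(ltW rq) // -lerBlDr sub0r.
rewrite y1' in yxi.
have yp : 0 < eucl_sqnorm (y - p).
  rewrite lt0r sqn_ge0 andbT; apply/eqP => /sqn_eq0 /eqP; rewrite subr_eq0 => /eqP yp.
  by rewrite yp in yxi; clear - yxi xip; lra.
rewrite subr_ge0 in yrho.
have Ey : punctured p d0 y by split; rewrite ?y1' // yp /= (le_trans yrho).
have uy : u y <= C by apply: ub => //; rewrite yp.
have [d dp Hd] := within_continuous_dist uE Ey c0.
exists d => // z Vz zy; have [hz sz] := VV z Vz.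
have Ez : punctured p d0 z.
  by split; [exact: ltW|rewrite ball_neq_boundary //= (le_trans (Hlens z hz sz))].
have := Hd z Ez zy; rewrite ler_norml => /andP[_].
clear - uy; lra.
Qed.

(** The solution of G'' = N G' with slope a e^(Ns), normalized to vanish at
    s = -3. *)
Definition hopf (R : realType) (N a s : R) : R := a / N * (expR (N * s) - expR (N * -3)).

Lemma der_hopf (R : realType) (N a C s : R) : N != 0 ->
  der (fun s => C - hopf N a s) s (- (a * expR (N * s))).
Proof.
move=> N0; apply: der_eq.
  apply: der_sub; first exact: der_cst.
  apply: der_scale; apply: der_sub; last exact: der_cst.
  apply: der_comp; first exact: is_derive_expR.
  by apply: der_scale; exact: der_id.
by field.
Qed.

Lemma der_hopf_d (R : realType) (N a s : R) :
  der (fun s => - (a * expR (N * s))) s (- (N * (a * expR (N * s)))).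
Proof.
apply: der_eq.
  apply: der_opp; apply: der_scale; apply: der_comp; first exact: is_derive_expR.
  by apply: der_scale; exact: der_id.
by ring.
Qed.

Lemma hopf_mono (R : realType) (N a s t : R) : 0 < N -> 0 < a -> s <= t -> hopf N a s <= hopf N a t.
Proof.
move=> N0 a0 st; rewrite /hopf ler_pM2l ?divr_gt0 // lerD2r ler_expR ler_pM2l //.
Qed.

Lemma slope_cube_small (R : realType) (k s S : R) : 0 < k -> -3 <= s -> s <= S -> 3 < S ->
  k <= 1 / (4 * (S + 4)) -> k ^+ 2 * (s ^+ 2 + 1) <= 1 / 12.
Proof.
move=> k0 s3 sS S3 kS; have S40 : 0 < 4 * (S + 4) by lra.
have kS1 : k * (4 * (S + 4)) <= 1 by rewrite -ler_pdivlMr.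
have kk : 0 < k * (4 * (S + 4)) by rewrite mulr_gt0.
have sq : (k * (4 * (S + 4))) ^+ 2 <= 1 by move: kk kS1; set z := k * _; nra.
have sSq : s ^+ 2 + 1 <= (S + 4) ^+ 2 by nra.
have := ler_wpM2l (sqr_ge0 k) sSq.
move: sq; rewrite [(k * _) ^+ 2]exprMn [(4 * _) ^+ 2]exprMn.
by set q1 := (S + 4) ^+ 2; set q2 := k ^+ 2; lra.
Qed.

(** On the slab -3 < s < S the profile C - hopf equals C at s = -3 and is at
    least C - c up to s = S, so it lies above u on the whole boundary; at s
    >= -2 it is below C by a fixed amount. *)
Lemma hopf_bound (R : realType) (n : nat) (u F : 'rV[R]_n -> R) (A : 'rV[R]_n) (a0 : R)
    (a S C c : R) :
  (2 <= n)%N -> eucl_sqnorm A - a0 ^+ 2 = 1 -> Ck 2 (hyp_space R n) u ->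
  (forall x, hyp_space R n x -> - hyp_mean_curvature u x <= F x) ->
  0 < a -> 3 < S -> a * expR (n%:R * S) <= 1 / (4 * (S + 4)) ->
  hopf n%:R a S <= c ->
  (forall y, hyp_space R n y -> -3 <= geo A a0 y ->
     0 <= F y <= a * expR (n%:R * -3) / 32) ->
  (forall y, hyp_space R n y -> -3 <= geo A a0 y -> u y <= C) ->
  (forall y, hyp_space R n y -> S - 1 <= geo A a0 y -> u y <= C - c) ->
  (forall (V : set 'rV[R]_n) y, (forall z, V z -> hyp_space R n z /\ -3 <= geo A a0 z) ->
     closure V y -> ~ hyp_space R n y ->
     exists2 d : R, 0 < d & forall z, V z -> `|z - y| < d -> u z <= C - c) ->
  forall x, hyp_space R n x -> -2 <= geo A a0 x -> geo A a0 x < S ->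
  u x <= C - hopf n%:R a (-2).
Proof.
move=> n2 A1 uC2 uF ap S3 aS Sc HF uup udeep ubd x hx x2 xS.
pose N : R := n%:R; rewrite -/N in aS Sc HF *.
have N2 : 2 <= N by rewrite ler_nat.
have N0 : 0 < N by rewrite (lt_le_trans _ N2).
pose V : set 'rV[R]_n := [set y | hyp_space R n y /\ -3 < geo A a0 y < S].
have VV z : V z -> hyp_space R n z /\ -3 <= geo A a0 z by move=> [hz /andP[/ltW]].
pose G (s : R) : R := C - hopf N a s.
have GS s : s <= S -> C - c <= G s.
  by move=> sS; rewrite /G lerD2l lerN2 (le_trans _ Sc) // hopf_mono.
have Gx : u x <= G (geo A a0 x).
  apply: (@comparison R n u F A a0 V G (fun s => - (a * expR (N * s)))
    (fun s => - (N * (a * expR (N * s)))) A1 uC2 (@open_slab R n A a0 (-3) S)); last first.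
  - split=> //; rewrite xS andbT (lt_le_trans _ x2) //; clear; lra.
  - move=> y e cVy nVy e0.
    have [hy|nhy] := pselect (hyp_space R n y); last first.
      have [d dp Hd] := ubd V y VV cVy nhy.
      exists d => // z Vz /(Hd _ Vz) uz.
      have [_ /andP[_ /ltW /GS]] := Vz; clear - uz e0; lra.
    have gc := geo_continuous (A := A) (a0 := a0) hy.
    have [s3|s3] := leP (geo A a0 y) (-3).
      have Gc : {for y, continuous (G \o geo A a0)}.
        apply: continuous_comp; first exact: gc.
        by apply: der_continuous (der_hopf _ _ _ _); rewrite gt_eqF.
      have e2 : 0 < e / 2 by rewrite divr_gt0.
      have [d dp Hd] := continuous_at_dist Gc e2.
      exists d => // z Vz /Hd /=; have [hz sz] := VV z Vz.
      have uz := uup z hz sz.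
      have Gy : C <= G (geo A a0 y).
        rewrite /G lerDl oppr_ge0 (le_trans (hopf_mono N0 ap s3)) //.
        by rewrite /hopf subrr mulr0.
      by rewrite ler_norml => /andP[+ _]; clear - uz Gy e0; lra.
    have sS : S <= geo A a0 y.
      by rewrite leNgt; apply/negP => sS; apply: nVy; split=> //; rewrite s3.
    have [d dp Hd] := continuous_at_dist gc (ltr01 : 0 < 1 :> R).
    exists d => // z Vz /Hd; have [hz /andP[_ /ltW sz]] := Vz.
    rewrite ler_norml => /andP[s1 _].
    have uz : u z <= C - c by apply: udeep => //; clear - s1 sS; lra.
    by have := GS _ sz; clear - uz e0; lra.
  - move=> y s k [hy /andP[s3 sS]] sE kE.
    have kE' : k = a * expR (N * s) by rewrite kE opprK.
    have k0 : 0 < k by rewrite kE' mulr_gt0 // expR_gt0.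
    rewrite opprK -kE'.
    have /andP[F0 F1] := HF y hy (ltW s3).
    rewrite -sE in s3 sS.
    have kS : k <= a * expR (N * S).
      by rewrite kE' ler_pM2l // ler_expR ler_pM2l // ltW.
    have k3 : a * expR (N * -3) <= k.
      by rewrite kE' ler_pM2l // ler_expR ler_pM2l // ltW.
    apply: hopf_ineq => //; [by clear - N2; lra|exact: ltW| |].
      exact: slope_cube_small k0 (ltW s3) (ltW sS) S3 (le_trans kS aS).
    have e0 : 0 < a * expR (N * -3) by rewrite mulr_gt0 // expR_gt0.
    clear - F1 k3 e0; lra.
  - by move=> y _; exact: der_hopf_d.
  - by move=> y _; exists 1 => // s _; apply: der_hopf; rewrite gt_eqF.
  - by move=> y [hy _]; exact: uF.
  - by move=> y [].
by apply: le_trans Gx _; rewrite /G lerD2l lerN2 hopf_mono.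
Qed.

(** The infinite barrier over the lens itself, so that only the values at
    infinity enter. With D = ln r the variable t = ln s - ln r is at most
    -ln q, because s q <= r. *)
Lemma deep_lens_bound (R : realType) (n : nat) (u : 'rV[R]_n -> R) (xi : 'rV[R]_n)
    (r K C : R) :
  (2 <= n)%N -> 0 < K -> Ck 2 (hyp_space R n) u ->
  (forall x, hyp_space R n x -> - hyp_mean_curvature u x <= decay K x) ->
  0 < r -> r <= 1 -> eucl_sqnorm xi = 1 + r ^+ 2 ->
  (forall y, hyp_space R n y -> geo (r^-1 *: xi) r^-1 y * (1 - eucl_sqnorm y) <= r) ->
  (forall y, hyp_space R n y -> -3 <= geo (r^-1 *: xi) r^-1 y -> decay K y <= 1 / 16) ->
  (forall (V : set 'rV[R]_n) y,
     (forall z, V z -> hyp_space R n z /\ -3 <= geo (r^-1 *: xi) r^-1 z) ->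
     closure V y -> ~ hyp_space R n y ->
     exists2 d : R, 0 < d & forall z, V z -> `|z - y| < d -> u z <= C) ->
  forall y, hyp_space R n y -> 2 < geo (r^-1 *: xi) r^-1 y ->
  u y <= C + scherk (29 * K) (ln r) (geo (r^-1 *: xi) r^-1 y).
Proof.
move=> n2 K0 uC2 uF r0 r1 xiE Hsr HF ubd y hy sy.
set A := r^-1 *: xi in Hsr HF ubd sy *.
have A1 : eucl_sqnorm A - r^-1 ^+ 2 = 1.
  by rewrite /A sqnE dotZl dotZr -sqnE xiE; field; rewrite gt_eqF.
have K29 : 0 < 29 * K by rewrite mulr_gt0.
have W (s : R) : 2 < s -> -3 <= s by clear => ?; lra.
apply: (@scherk_bound R n u (decay K) A r^-1 setT (29 * K) (ln r) C n2 A1 K29 uC2 openT uF);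
  last by split.
  move=> z [hz _ sz]; split; first by apply: decay_ge0; exact: ltW.
    by apply: HF => //; exact: W.
  have qz : 0 < 1 - eucl_sqnorm z by rewrite subr_gt0.
  have l0 := depth_ln_le0 z.
  have sz0 : 0 < geo A r^-1 z by rewrite (lt_trans _ sz).
  have lsr : ln (geo A r^-1 z) + ln (1 - eucl_sqnorm z) <= ln r.
    by rewrite -lnM ?posrE // ler_ln ?posrE ?(mulr_gt0 sz0 qz) //; exact: (Hsr z hz).
  have ls0 : 0 <= ln (geo A r^-1 z) by apply: ln_ge0; clear - sz; lra.
  have lr0 : ln r <= 0 by exact: ln_le0.
  by apply: decay_le_tau => //; clear - l0 lsr ls0 lr0; lra.
move=> z e' cVz nVz e0.
have nhz : ~ hyp_space R n z by move=> hz; apply: nVz.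
have VV z0 : [/\ hyp_space R n z0, [set: 'rV[R]_n] z0 & 2 < geo A r^-1 z0] ->
    hyp_space R n z0 /\ -3 <= geo A r^-1 z0 by move=> [? _ /W].
have [d dp Hd] := ubd _ _ VV cVz nhz.
by exists d => // z0 Vz0 /(Hd _ Vz0) H; rewrite (le_lt_trans H) // ltrDl.
Qed.

(** The gain w depends on c but not on c', which is what makes the infimum
    argument possible. The parameters are fixed in this order: S and T from
    c; the slope a from S; w from a; finally the distance to p below which
    the lens is small enough for the decay and the boundary values. *)
Lemma puncture_improvement (R : realType) (n : nat) (u : 'rV[R]_n -> R) (p : 'rV[R]_n) (K L d0 : R) :
  (2 <= n)%N -> 0 < K -> eucl_sqnorm p = 1 -> Ck 2 (hyp_space R n) u ->
  (forall x, hyp_space R n x -> - hyp_mean_curvature u x <= decay K x) ->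
  0 < d0 -> {within punctured p d0, continuous u} ->
  (forall e, 0 < e -> exists2 d : R, 0 < d & forall y, eucl_sqnorm y = 1 ->
     0 < eucl_sqnorm (y - p) < d ^+ 2 -> u y <= L + e) ->
  forall c : R, 0 < c -> exists2 w : R, 0 < w <= c / 2 & forall c', c <= c' ->
   (exists2 d : R, 0 < d & forall x, hyp_space R n x ->
      eucl_sqnorm (x - p) < d ^+ 2 -> u x <= L + c') ->
   (exists2 d : R, 0 < d & forall x, hyp_space R n x ->
      eucl_sqnorm (x - p) < d ^+ 2 -> u x <= L + c' - w).
Proof.
move=> n2 K0 p1 uC2 uF d00 uE ub c c0.
have K29 : 0 < 29 * K by rewrite mulr_gt0.
have c4 : 0 < c / 4 by rewrite divr_gt0.
have c8 : 0 < c / 8 by rewrite divr_gt0.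
have [S [T [S3 T0 HST]]] := scherk_tail K29 c4.
pose N : R := n%:R.
have N2 : 2 <= N by rewrite ler_nat.
have N0 : 0 < N by rewrite (lt_le_trans _ N2).
have S4 : 0 < S + 4 by clear - S3; lra.
(* The largest slope of the profile, attained at s = S. *)
pose kap : R := Num.min (c / 2) (1 / (4 * (S + 4))).
have kap0 : 0 < kap by rewrite lt_min !divr_gt0 // mulr_gt0.
have [kapc kapS] : kap <= c / 2 /\ kap <= 1 / (4 * (S + 4)) by rewrite !ge_min !lexx orbT.
pose a : R := kap * expR (- (N * S)).
have a0 : 0 < a by rewrite mulr_gt0 // expR_gt0.
have aS : a * expR (N * S) = kap by rewrite /a -mulrA -expRD addNr expR0 mulr1.
have hopfS : hopf N a S <= c / 2.
  apply: le_trans kapc; rewrite -aS /hopf mulrAC ler_pdivrMr //.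
  have e1 : 0 < expR (N * S) by exact: expR_gt0.
  have e2 : 0 < expR (N * -3) by exact: expR_gt0.
  rewrite -[leRHS]mulrA ler_pM2l //; clear - e1 e2 N2; nra.
have w0 : 0 < hopf N a (-2).
  rewrite /hopf mulr_gt0 ?divr_gt0 ?subr_gt0 ?ltr_expR ?ltr_pM2l //; clear; lra.
have wc : hopf N a (-2) <= c / 2.
  by apply: le_trans hopfS; apply: hopf_mono => //; clear - S3; lra.
exists (hopf N a (-2)); first by rewrite w0.
move=> c' cc' [dc dc0 Hc].
have cF0 : 0 < Num.min (1 / 16) (a * expR (N * -3) / 32) :> R.
  by rewrite lt_min !divr_gt0 // mulr_gt0 // expR_gt0.
have [dF dF0 HF] := decay_small p1 K0 cF0.
have c16 : 0 < c / 16 by rewrite divr_gt0.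
have [db db0 Hb] := ub _ c16.
pose m : R := Num.min (Num.min d0 dF) (Num.min db dc).
have m0 : 0 < m by rewrite !lt_min d00 dF0 db0 dc0.
have sq_le (b : R) : m <= b -> m ^+ 2 <= b ^+ 2.
  by clear - m0 => mb; rewrite lerXn2r ?nnegrE ?(ltW m0) // (le_trans (ltW m0)).
have [[/sq_le md0 /sq_le mdF] [/sq_le mdb /sq_le mdc]] :
    (m <= d0 /\ m <= dF) /\ (m <= db /\ m <= dc).
  by rewrite /m !ge_min !lexx !orbT.
(* The lens lies within 12 eta of p; r <= eta < e^(-2T) gives ln r <=
   -2T. *)
pose d : R := Num.min (m / 12) (Num.min (1 / 2) (expR (- (2 * T)))).
have dp : 0 < d by rewrite !lt_min divr_gt0 //= divr_gt0 //= expR_gt0.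
have [dm [d2 dT]] : d <= m / 12 /\ (d <= 1 / 2 /\ d <= expR (- (2 * T))).
  by rewrite /d !ge_min !lexx !orbT.
exists d => // x hx xd.
pose eta : R := Num.sqrt (eucl_sqnorm (x - p)).
have xp0 := ball_neq_boundary p1 hx.
have eta0 : 0 < eta by rewrite sqrtr_gt0.
have etaE : eta ^+ 2 = eucl_sqnorm (x - p) by rewrite sqr_sqrtr // ltW.
have etad : eta < d by rewrite -(@ltr_pXn2r _ 2) ?nnegrE ?(ltW eta0) ?(ltW dp) // etaE.
have eta2 : eta <= 1 / 2 by exact: le_trans (ltW etad) d2.
have [xi [r [[r0 reta xiE] xip xs Hlens Hsr]]] := lens_halfspace n2 p1 hx eta0 eta2 etaE.
have e144 : 144 * eta ^+ 2 < m ^+ 2 by clear - eta0 etad dm; nra.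
have rd : r <= d by exact: le_trans reta (ltW etad).
have lnr : ln r <= - (2 * T).
  by rewrite -[leRHS]expRK ler_ln ?posrE ?expR_gt0 // (le_trans rd).
have r1 : r <= 1 by apply: le_trans rd _; apply: le_trans d2 _; clear; lra.
have A1 : eucl_sqnorm (r^-1 *: xi) - r^-1 ^+ 2 = 1.
  by rewrite sqnE dotZl dotZr -sqnE xiE; field; rewrite gt_eqF.
have lens y : hyp_space R n y -> -3 <= geo (r^-1 *: xi) r^-1 y -> eucl_sqnorm (y - p) < m ^+ 2.
  by move=> hy s3; apply: lt_trans e144; exact: Hlens.
have Fsmall y : hyp_space R n y -> -3 <= geo (r^-1 *: xi) r^-1 y ->
    decay K y <= 1 / 16 /\ decay K y <= a * expR (N * -3) / 32.
  move=> hy s3; apply/andP; rewrite -le_min; apply: HF => //.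
  exact: lt_le_trans (lens y hy s3) mdF.
have bdry (V : set 'rV[R]_n) y :
    (forall z, V z -> hyp_space R n z /\ -3 <= geo (r^-1 *: xi) r^-1 z) ->
    closure V y -> ~ hyp_space R n y ->
    exists2 dd : R, 0 < dd & forall z, V z -> `|z - y| < dd -> u z <= L + c / 8.
  have -> : L + c / 8 = L + c / 16 + c / 16 by clear; lra.
  apply: (lens_at_infinity (rho := 144 * eta ^+ 2) p1 c16 uE _ r0 xip).
  - move=> z z1 /andP[z2 z3]; apply: Hb => //; rewrite z2 /=.
    exact: le_lt_trans z3 (lt_le_trans e144 mdb).
  - exact: le_trans (ltW e144) md0.
  - by move=> z hz sz; apply/ltW/Hlens.
have deep y : hyp_space R n y -> S - 1 <= geo (r^-1 *: xi) r^-1 y -> u y <= L + c' - c / 2.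
  move=> hy sy; have sy2 : 2 < geo (r^-1 *: xi) r^-1 y by clear - S3 sy; lra.
  have F16 z (hz : hyp_space R n z) s3 := (Fsmall z hz s3).1.
  have U := deep_lens_bound n2 K0 uC2 uF r0 r1 xiE Hsr F16 bdry hy sy2.
  have := HST _ _ sy lnr.
  clear - U cc' c0; lra.
have [xS|xS] := leP S (geo (r^-1 *: xi) r^-1 x).
  apply: le_trans (deep x hx _) _; first by apply: le_trans xS; rewrite gerBl.
  by rewrite lerD2l lerN2.
apply: (hopf_bound n2 A1 uC2 uF a0 S3 _ hopfS _ _ deep _ hx xs xS).
- by rewrite aS.
- move=> y hy s3; have [_ ->] := Fsmall y hy s3.
  by rewrite andbT; apply: decay_ge0; exact: ltW.
- by move=> y hy s3; apply: Hc => //; exact: lt_le_trans (lens y hy s3) mdc.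
move=> V y VV cVy nhy; have [dd ddp Hd] := bdry V y VV cVy nhy.
exists dd => // z Vz /(Hd _ Vz) uz; apply: le_trans uz _.
clear - cc' c0; lra.
Qed.

(** * The upper limit at a puncture *)

(** If the infimum of the admissible excesses c were positive, an excess
    close to it could be lowered by the gain w below the infimum. *)
Lemma limsup_at_puncture (R : realType) (n : nat) (u : 'rV[R]_n -> R) (p : 'rV[R]_n) (K L d0 : R) :
  (2 <= n)%N -> 0 < K -> eucl_sqnorm p = 1 -> Ck 2 (hyp_space R n) u ->
  (forall x, hyp_space R n x -> - hyp_mean_curvature u x <= decay K x) ->
  0 < d0 -> {within punctured p d0, continuous u} ->
  (forall e, 0 < e -> exists2 d : R, 0 < d & forall y, eucl_sqnorm y = 1 ->
     0 < eucl_sqnorm (y - p) < d ^+ 2 -> u y <= L + e) ->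
  forall e, 0 < e -> exists2 d : R, 0 < d & forall x, hyp_space R n x ->
    eucl_sqnorm (x - p) < d ^+ 2 -> u x <= L + e.
Proof.
move=> n2 K0 p1 uC2 uF d00 uE ub.
pose E : set R := [set c | 0 <= c /\ exists2 d : R, 0 < d & forall x, hyp_space R n x ->
    eucl_sqnorm (x - p) < d ^+ 2 -> u x <= L + c].
have E0 : E !=set0.
  have [M [d dp Hd]] := bounded_above_near_puncture n2 K0 p1 uC2 uF d00 uE ub.
  exists (Num.max 0 (M - L)); split; first by rewrite le_max lexx.
  exists d => // x hx /(Hd _ hx) ux.
  have : M - L <= Num.max 0 (M - L) by rewrite le_max lexx orbT.
  lra.
have lE : has_lbound E by exists 0 => c [].
have hE : has_inf E by [].
have cs0 : inf E <= 0.
  rewrite leNgt; apply/negP => cs.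
  have [w /andP[w0 wc] Hw] := puncture_improvement n2 K0 p1 uC2 uF d00 uE ub cs.
  have [c [c0 Hc] cw] := inf_adherent w0 hE.
  have Ec : E c by split.
  have cE : inf E <= c by exact: ge_inf.
  have [d dp Hd] := Hw c cE Hc.
  have : E (c - w).
    split; first by lra.
    by exists d => // x hx /(Hd _ hx); rewrite addrA.
  by move=> /(ge_inf lE); lra.
move=> e e0; have [c [c0 [d dp Hd]] ce] := inf_adherent e0 hE.
by exists d => // x hx /(Hd _ hx); lra.
Qed.

(** * Lower bounds for the hyperbolic distance *)

Lemma coord_derivable (R : realType) (n : nat) (c : R -> 'rV[R]_n) (t : R) (i : 'I_n) :
  derivable c t 1 -> der (fun s => c s 0 i) t (('D_1 c t) 0 i).
Proof.
move=> dc; have dci : derivable (fun s => c s 0 i) t 1 by exact: ((derivable_mxP _ _ _).1 dc 0 i).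
split=> //; by rewrite derive_mx // mxE.
Qed.

Lemma hyp_metric_norm (R : realType) (n : nat) (x X : 'rV[R]_n) : hyp_space R n x ->
  metric_norm (@hyp_metric R n) x X = 2 / (1 - eucl_sqnorm x) * Num.sqrt (eucl_sqnorm X).
Proof.
move=> hx; have q0 : 0 < 1 - eucl_sqnorm x by rewrite subr_gt0.
have l0 : 0 <= 2 / (1 - eucl_sqnorm x) by rewrite divr_ge0 // ltW.
rewrite /metric_norm /metric_dot /hyp_metric mul_mx_scalar -scalemxAl mxE mxE.
have -> : \sum_j X 0 j * X^T j 0 = eucl_sqnorm X.
  by rewrite sqnE; apply: eq_bigr => j _; rewrite mxE.
by rewrite sqrtrM ?sqr_ge0 // sqrtr_sqr ger0_norm.
Qed.

(** The speed of a curve is at least its radial component, which is the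
    derivative of ln (1 - |x|^2). *)
Lemma hyp_metric_norm_ge (R : realType) (n : nat) (x X : 'rV[R]_n) : hyp_space R n x ->
  - (2 * dot x X) / (1 - eucl_sqnorm x) <= metric_norm (@hyp_metric R n) x X.
Proof.
move=> hx; have q0 : 0 < 1 - eucl_sqnorm x by rewrite subr_gt0.
rewrite hyp_metric_norm // mulrAC ler_pM2r ?invr_gt0 // -mulrN ler_pM2l //.
apply: le_trans (ler_norm _) _; rewrite normrN -sqrtr_sqr ler_wsqrtr //.
apply: le_trans (cauchy_schwarz _ _) _.
by rewrite ler_piMl ?sqn_ge0 // ltW.
Qed.

Lemma curve_length_ge (R : realType) (n : nat) (c : R -> 'rV[R]_n) :
  Ck 1 setT c -> (forall t, t \in `[0, 1] -> hyp_space R n (c t)) ->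
  ln (1 - eucl_sqnorm (c 1)) - ln (1 - eucl_sqnorm (c 0)) <=
    curve_length (@hyp_metric R n) c.
Proof.
move=> [cc C1] hc; have [dc0 [cdc _]] := C1 1.
have dc t : derivable c t 1 by exact: dc0.
have cE : derive1 c = 'D_1 c by apply/funext => t; rewrite derive1E.
have cont t : {for t, continuous c} by exact: cc.
have sc t : {for t, continuous (fun s => eucl_sqnorm (c s))}.
  by apply: (@continuous_comp _ _ _ c (@eucl_sqnorm R n)); [exact: cont|exact: sqn_continuous].
have ds t : der (fun s => eucl_sqnorm (c s)) t (2 * dot (c t) (derive1 c t)).
  apply: der_eq; first by apply: der_sum => i; apply: der_exp; apply: coord_derivable; exact: dc.
  by rewrite /dot mulr_sumr; apply: eq_bigr => i _; rewrite cE expr1 mulrA.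
pose F t : R := ln (1 - eucl_sqnorm (c t)).
pose f t : R := - (2 * dot (c t) (derive1 c t)) / (1 - eucl_sqnorm (c t)).
have dF t : t \in `[0, 1] -> der F t (f t).
  move=> /hc ht; apply: der_eq.
    apply: der_comp; first by apply: is_derive1_ln; rewrite subr_gt0.
    by apply: der_sub; [exact: der_cst|exact: ds].
  by rewrite /f sub0r mulrC.
have cd t i : {for t, continuous (fun s => derive1 c s 0 i)}.
  rewrite cE; apply: (@continuous_comp _ _ _ ('D_1 c) (fun M : 'rV[R]_n => M 0 i)).
    exact: cdc.
  exact: coord_continuous.
have ccoord t i : {for t, continuous (fun s => c s 0 i)}.
  by apply: (@continuous_comp _ _ _ c (fun M : 'rV[R]_n => M 0 i)); [exact: cont|exact: coord_continuous].
have cq t : t \in `[0, 1] -> {for t, continuous (fun s => (1 - eucl_sqnorm (c s))^-1)}.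
  move=> /hc /hyp_spaceN0 ht; apply: cts_inv => //.
  by apply: cts_sub; [exact: cts_cst|exact: sc].
have cf t : t \in `[0, 1] -> {for t, continuous f}.
  move=> t01; apply: cts_mul; last exact: cq.
  have -> : (fun t => - (2 * dot (c t) (derive1 c t))) = (fun t => -2 * dot (c t) (derive1 c t)).
    by apply/funext => s; ring.
  apply: cts_mul; first exact: cts_cst.
  by apply: continuous_sumr => i s; apply: cts_mul; [exact: ccoord|exact: cd].
have cN t : t \in `[0, 1] ->
    {for t, continuous (fun s => 2 / (1 - eucl_sqnorm (c s)) * Num.sqrt (eucl_sqnorm (derive1 c s)))}.
  move=> t01; apply: cts_mul.
    by apply: cts_mul; [exact: cts_cst|exact: cq].
  apply: (@continuous_comp _ _ _ (fun s => eucl_sqnorm (derive1 c s)) Num.sqrt); last exact: sqrt_continuous.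
  apply: (@continuous_comp _ _ _ (derive1 c) (@eucl_sqnorm R n)); last exact: sqn_continuous.
  by rewrite cE; exact: cdc.
have wf : {within `[0, 1], continuous f}.
  by apply: continuous_in_subspaceT => t; rewrite inE => t01; exact: cf.
have wN : {within `[0, 1], continuous
    (fun s => 2 / (1 - eucl_sqnorm (c s)) * Num.sqrt (eucl_sqnorm (derive1 c s)))}.
  by apply: continuous_in_subspaceT => t; rewrite inE => t01; exact: cN.
have i01 : compact (`[0, 1]%classic : set R) by exact: segment_compact.
have in01 (t : R) : t \in `]0, 1[ -> t \in `[0, 1] by apply: subset_itv_oo_cc.
have e0 : (0 : R) \in `[0, 1] by rewrite in_itv /= lexx ler01.
have e1 : (1 : R) \in `[0, 1] by rewrite in_itv /= lexx ler01.
have FTC : \int[lebesgue_measure]_(t in `[0, 1]) f t = F 1 - F 0.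
  rewrite /Rintegral (@continuous_FTC2 R f F 0 1 ltr01 wf) //=.
    split.
    - by move=> t /in01 /dF [].
    - by apply: cvg_at_right_filter; exact: der_continuous (dF _ e0).
    - by apply: cvg_at_left_filter; exact: der_continuous (dF _ e1).
  by move=> t /in01 /dF [_ <-]; rewrite derive1E.
have -> : curve_length (@hyp_metric R n) c = \int[lebesgue_measure]_(t in `[0, 1])
    (2 / (1 - eucl_sqnorm (c t)) * Num.sqrt (eucl_sqnorm (derive1 c t))).
  rewrite /curve_length /Rintegral; congr fine; apply: eq_integral => t.
  by rewrite inE => t01; rewrite hyp_metric_norm //; exact: hc.
rewrite -/(F 1) -/(F 0) -FTC; apply: le_Rintegral.
- exact: measurable_itv.
- exact: continuous_compact_integrable.
- exact: continuous_compact_integrable.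
- by move=> t t01; rewrite -hyp_metric_norm ?hyp_metric_norm_ge //; exact: hc.
Qed.

(** * From the radial bound to logarithmic decay in the ball *)

Lemma curve_length_ge0 (R : realType) (n : nat) (g : 'rV[R]_n -> 'M[R]_n) (c : R -> 'rV[R]_n) :
  0 <= curve_length g c.
Proof. by apply: Rintegral_ge0 => t _; exact: sqrtr_ge0. Qed.

(** Convexity of the ball: it makes the set of curves between two points
    nonempty, without which the infimum defining the distance would be
    meaningless. *)
Lemma hyp_space_segment (R : realType) (n : nat) (x y : 'rV[R]_n) (t : R) :
  hyp_space R n x -> hyp_space R n y -> 0 <= t -> t <= 1 ->
  hyp_space R n (t *: (y - x) + x).
Proof.
rewrite /hyp_space /= => hx hy t0 t1.
have E : eucl_sqnorm (t *: (y - x) + x) =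
    (1 - t) * eucl_sqnorm x + t * eucl_sqnorm y - t * (1 - t) * eucl_sqnorm (y - x).
  by rewrite sqn_line sqnB !dotE [dot x y]dotC -sqnE; ring.
have tt : 0 <= t * (1 - t) * eucl_sqnorm (y - x).
  by rewrite mulr_ge0 ?sqn_ge0 // mulr_ge0 // subr_ge0.
rewrite E.
move: hx hy tt; set a := eucl_sqnorm x; set b := eucl_sqnorm y; set d := _ * eucl_sqnorm (y - x).
clear - t0 t1 => hx hy tt.
have [t2|t2] := leP t (1 / 2); nra.
Qed.

Lemma segment_Ck1 (R : realType) (n : nat) (v x : 'rV[R]_n) :
  Ck 1 setT (fun t : R => t *: v + x).
Proof.
have cl : continuous (fun t : R => t *: v + x).
  move=> t; apply: cvgD; last exact: cvg_cst.
  exact: (@scalel_continuous R _ v t).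
have dl (w t : R) : is_derive t w (fun t : R => t *: v + x) (w *: v).
  have E : (fun h : R => h^-1 *: (((fun t : R => t *: v + x) \o shift t) (h *: w) - (t *: v + x)))
      = (fun h : R => h^-1 *: (h *: (w *: v))).
    apply/funext => h /=; congr (_ *: _).
    by rewrite opprD addrACA subrr addr0 -scalerBl addrK [h *: w]mulrC scalerA mulrC.
  have L : (fun h : R => h^-1 *: (h *: (w *: v))) @ 0^' --> w *: v.
    apply: cvg_near_cst; near=> h; rewrite scalerK //.
    by near: h; exact: nbhs_dnbhs_neq.
  split; first by rewrite /derivable E; apply/cvg_ex; exists (w *: v).
  by rewrite /derive E; exact/cvg_lim.
split; first by move=> t _; exact: cl.
move=> w; split; first by move=> t _; case: (dl w t).
have -> : (fun t : R => 'D_w (fun t : R => t *: v + x) t) = (fun _ : R => w *: v).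
  by apply/funext => t; case: (dl w t).
by split; [move=> t _; exact: cst_continuous|].
Unshelve. all: by end_near. Qed.

(** Both bounds hold for the length of every admissible curve and pass to
    the infimum; the first one matters because the radial bound is only
    available for nonnegative arguments. *)
Lemma hyp_dist_lower_bounds (R : realType) (n : nat) (x o : 'rV[R]_n) :
  hyp_space R n x -> hyp_space R n o ->
  0 <= hyp_dist x o /\ ln (1 - eucl_sqnorm o) - ln (1 - eucl_sqnorm x) <= hyp_dist x o.
Proof.
move=> hx ho; rewrite /hyp_dist /riem_dist; set E := [set l | _].
have E0 : E !=set0.
  exists (curve_length (@hyp_metric R n) (fun t : R => t *: (o - x) + x)).
  exists (fun t : R => t *: (o - x) + x); split=> //.
  - exact: segment_Ck1.
  - by move=> t; rewrite in_itv /= => /andP[t0 t1]; exact: hyp_space_segment.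
  - by rewrite scale0r add0r.
  - by rewrite scale1r subrK.
split; apply: lb_le_inf => // l [c [cC1 cA c0 c1 ->]].
  exact: curve_length_ge0.
by rewrite -c0 -c1; exact: curve_length_ge.
Qed.

(** On [0, r] the square root is at least its value at r, so r sqrt(phi(r))
    is bounded by the integral. *)
Lemma decr_sqrt_integrable (R : realType) (phi : R -> R) :
  {within `[0, +oo[, continuous phi} ->
  (forall r s : R, 0 <= r -> r <= s -> phi s <= phi r) ->
  (\int[lebesgue_measure]_(r in `[0%R, +oo[) (Num.sqrt (phi r))%:E < +oo)%E ->
  exists2 C : R, 0 < C & forall r, 0 <= r -> phi r <= C / (1 + r) ^+ 2.
Proof.
move=> cphi dphi iphi.
set I := (\int[lebesgue_measure]_(r in `[0%R, +oo[) (Num.sqrt (phi r))%:E)%E in iphi.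
have I0 : (0 <= I)%E by apply: integral_ge0 => r _; rewrite lee_fin sqrtr_ge0.
have Ifin : I \is a fin_num by rewrite ge0_fin_numE.
pose J : R := fine I.
have J0 : 0 <= J by exact: fine_ge0.
have key (r : R) : 0 <= r -> Num.sqrt (phi r) * r <= J.
  move=> r0; rewrite -lee_fin /J fineK //.
  have -> : ((Num.sqrt (phi r) * r)%:E = \int[lebesgue_measure]_(s in `[0%R, r]) (cst (Num.sqrt (phi r))%:E s))%E.
    rewrite integral_cst //= lebesgue_measure_itv /= lte_fin.
    case: ltP => r0'; first by rewrite -EFinB subr0 EFinM.
    have -> : r = 0 by apply/eqP; rewrite eq_le r0 r0'.
    by rewrite mulr0 mule0.
  have cs : {within `[0, +oo[, continuous (Num.sqrt \o phi)}.
    by apply: within_continuous_comp => // s _; exact: sqrt_continuous.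
  have mI : measurable (`[0%R, +oo[%classic : set R) by exact: measurable_itv.
  have ms := (measurable_realfun.measurable_EFinP _ _).2
    (measurable_realfun.subspace_continuous_measurable_fun mI cs).
  have sub : (`[0%R, r]%classic : set R) `<=` `[0%R, +oo[%classic.
    by move=> s /=; rewrite !in_itv /= => /andP[-> _].
  apply: (@le_trans _ _ (\int[lebesgue_measure]_(s in `[0%R, r]) (Num.sqrt (phi s))%:E)%E).
    apply: ge0_le_integral => //.
    - by move=> s _; rewrite lee_fin sqrtr_ge0.
    - exact: measurable_funS sub ms.
    - move=> s /=; rewrite in_itv /= => /andP[s0 sr].
      by rewrite lee_fin ler_wsqrtr // dphi.
  by apply: ge0_subset_integral => // s _; rewrite lee_fin sqrtr_ge0.
(* The term phi(0) takes care of small r, and the summand 1 of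
   positivity of the constant. *)
exists (2 * (`|phi 0| + J ^+ 2) + 1); first by rewrite ltr_wpDl // mulr_ge0 // addr_ge0 // sqr_ge0.
move=> r r0; have r1 : 0 < (1 + r) ^+ 2 by rewrite exprn_gt0 // ltr_wpDr.
rewrite ler_pdivlMr //.
have [p0|p0] := leP (phi r) 0.
  apply: (@le_trans _ _ 0); first by rewrite pmulr_lle0.
  by rewrite addr_ge0 // mulr_ge0 // addr_ge0 // sqr_ge0.
have pr : phi r * r ^+ 2 <= J ^+ 2.
  have -> : phi r * r ^+ 2 = (Num.sqrt (phi r) * r) ^+ 2 by rewrite exprMn sqr_sqrtr // ltW.
  by rewrite lerXn2r ?nnegrE ?mulr_ge0 ?sqrtr_ge0 // key.
have p00 : phi r <= `|phi 0| by apply: le_trans (ler_norm _); exact: dphi.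
have rr : (1 + r) ^+ 2 <= 2 * (1 + r ^+ 2) by clear; have := sqr_ge0 (1 - r); lra.
have := ler_wpM2l (ltW p0) rr.
clear - pr p00; lra.
Qed.

Lemma decay_of_radial_bound (R : realType) (n : nat) (o : 'rV[R]_n) (phi : R -> R) :
  hyp_space R n o ->
  {within `[0, +oo[, continuous phi} ->
  (forall r s : R, 0 <= r -> r <= s -> phi s <= phi r) ->
  (\int[lebesgue_measure]_(r in `[0%R, +oo[) (Num.sqrt (phi r))%:E < +oo)%E ->
  exists2 K : R, 0 < K & forall x, hyp_space R n x -> phi (hyp_dist x o) <= decay K x.
Proof.
move=> ho cphi dphi iphi.
have [C C0 HC] := decr_sqrt_integrable cphi dphi iphi.
pose r0 : R := - ln (1 - eucl_sqnorm o).
have r00 : 0 <= r0 by rewrite oppr_ge0; exact: depth_ln_le0.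
have K0 : 0 < C * (1 + r0) ^+ 2 by rewrite mulr_gt0 // exprn_gt0 // ltr_wpDr.
exists (C * (1 + r0) ^+ 2) => // x hx.
have [d0 d1] := hyp_dist_lower_bounds hx ho.
apply: le_trans (HC _ d0) _.
have l0 := depth_ln_le0 x.
rewrite /decay; set l := ln (1 - eucl_sqnorm x) in d1 l0 *; set d := hyp_dist x o in d0 d1 *.
rewrite ler_pdivrMr; last by rewrite exprn_gt0 // ltr_wpDr.
rewrite mulrAC ler_pdivlMr; last by rewrite exprn_gt0 //; clear - l0; lra.
rewrite -mulrA ler_pM2l // -exprMn lerXn2r ?nnegrE //.
- by clear - l0; lra.
- by rewrite mulr_ge0 // addr_ge0.
- have dr : 1 - l <= 1 + r0 + d by move: d1; rewrite /r0; clear; lra.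
  by have := mulr_ge0 r00 d0; clear - dr; lra.
Qed.

(** * Symmetry, and the limit at a puncture *)

(** Being C^k on an open set only depends on the values there, although the
    iterated derivatives are taken for functions defined everywhere. *)
Lemma Ck_eq_on (R : realType) (V W : normedModType R) (k : nat) (A : set V) (f g : V -> W) :
  open A -> (forall x, A x -> f x = g x) -> Ck k A f -> Ck k A g.
Proof.
move=> oA; elim: k f g => [|k IH] f g fg.
  move=> [cf _]; split=> // x Ax.
  have nE : {near x, f =1 g} by apply: filterS (open_nbhs_nbhs (conj oA Ax)) => y; exact: fg.
  by have := cf x Ax; rewrite /prop_for /continuous_at -(fg x Ax); apply: cvg_trans; exact: near_eq_cvg.
have nE x : A x -> {near x, f =1 g}.
  by move=> Ax; apply: filterS (open_nbhs_nbhs (conj oA Ax)) => y; exact: fg.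
move=> [cf C]; split.
  move=> x Ax; have := cf x Ax; rewrite /prop_for /continuous_at -(fg x Ax).
  by apply: cvg_trans; exact: near_eq_cvg (nE x Ax).
move=> v; have [dv Cv] := C v; split.
  by move=> x Ax; apply: near_eq_derivable (nE x Ax) (dv x Ax).
by apply: IH Cv => x Ax; exact: near_eq_derive (nE x Ax).
Qed.

Lemma Ck_opp (R : realType) (V W : normedModType R) (k : nat) (A : set V) (f : V -> W) :
  open A -> Ck k A f -> Ck k A (fun x => - f x).
Proof.
move=> oA; elim: k f => [|k IH] f [cf C].
  by split=> // x Ax; apply: cvgN; exact: cf.
split; first by move=> x Ax; apply: cvgN; exact: cf.
move=> v; have [dv Cv] := C v; split.
  by move=> x Ax; apply: derivableN; exact: dv.
apply: (Ck_eq_on (f := fun x => - 'D_v f x) oA); last exact: IH.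
by move=> x Ax; rewrite (deriveN (dv x Ax)).
Qed.

Lemma mc_term_opp (R : realType) (n : nat) (p x : 'rV[R]_n) (H H' : 'I_n -> 'I_n -> R) (i : 'I_n) :
  (forall a b, H' a b = - H a b) -> mc_term (- p) H' x i = - mc_term p H x i.
Proof.
move=> HE; rewrite /mc_term.
have -> : eucl_sqnorm (- p) = eucl_sqnorm p by rewrite !sqnE dotNl dotNr opprK.
have -> : \sum_j (- p) 0 j * H' i j = \sum_j p 0 j * H i j.
  by apply: eq_bigr => j _; rewrite HE mxE mulrNN.
by rewrite HE mxE; ring.
Qed.

Lemma mean_curvature_opp (R : realType) (n : nat) (u : 'rV[R]_n -> R) (x : 'rV[R]_n) :
  Ck 2 (hyp_space R n) u -> hyp_space R n x ->
  hyp_mean_curvature (fun y => - u y) x = - hyp_mean_curvature u x.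
Proof.
move=> uC2 hx; have oB := @hyp_space_open R n.
have uC2' := Ck_opp oB uC2.
rewrite !mean_curvature_expand // -sumrN; apply: eq_bigr => i _.
have [_ C] := uC2.
have D1 v y : hyp_space R n y -> dir_deriv v (fun y => - u y) y = - dir_deriv v u y.
  by move=> hy; apply: deriveN; exact: (C v).1.
have pE : eucl_grad (fun y => - u y) x = - eucl_grad u x.
  by apply/rowP => j; rewrite !mxE D1.
have HE v w : dir_deriv v (dir_deriv w (fun y => - u y)) x = - dir_deriv v (dir_deriv w u) x.
  have E : {near x, dir_deriv w (fun y => - u y) =1 (fun y => - dir_deriv w u y)}.
    by apply: filterS (open_nbhs_nbhs (conj oB hx)) => y; exact: D1.
  rewrite /dir_deriv (near_eq_derive _ E); apply: deriveN.
  by have [_ [_ /(_ v) [+ _]]] := C w; apply.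
by rewrite pE; apply: mc_term_opp => a b; exact: HE.
Qed.

Lemma continuous_within_of_dist (R : realType) (V : normedModType R) (E : set V) (v : V -> R) :
  (forall y, E y -> forall e, 0 < e -> exists2 d : R, 0 < d &
     forall x, E x -> `|x - y| < d -> `|v x - v y| <= e) ->
  {within E, continuous v}.
Proof.
move=> H; apply/subspace_continuousP => y Ey; apply/cvgrPdist_le => e e0.
have [d d0 Hd] := H y Ey e e0.
apply/nbhs_ballP; exists d => // x; rewrite -ball_normE /= distrC => xd Ex.
by rewrite distrC; exact: Hd.
Qed.

Lemma finite_isolated (R : realType) (n k : nat) (p : 'I_k -> 'rV[R]_n) (x : 'rV[R]_n) :
  exists2 d : R, 0 < d & forall i, p i != x -> d <= `|p i - x|.
Proof.
exists (\big[Num.min/1]_(i | p i != x) `|p i - x|) => [|i pix].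
  by apply: lt_bigmin => [|i pix]; rewrite ?ltr01 // normr_gt0 subr_eq0.
exact: bigmin_le_cond.
Qed.

Lemma limit_at_puncture (R : realType) (n : nat) (u : 'rV[R]_n -> R) (p : 'rV[R]_n) (K L d0 : R) :
  (2 <= n)%N -> 0 < K -> eucl_sqnorm p = 1 -> Ck 2 (hyp_space R n) u ->
  (forall x, hyp_space R n x -> `|hyp_mean_curvature u x| <= decay K x) ->
  0 < d0 -> {within punctured p d0, continuous u} ->
  (forall e, 0 < e -> exists2 d : R, 0 < d & forall y, eucl_sqnorm y = 1 ->
     0 < eucl_sqnorm (y - p) < d ^+ 2 -> `|u y - L| <= e) ->
  forall e, 0 < e -> exists2 d : R, 0 < d & forall x, hyp_space R n x ->
    eucl_sqnorm (x - p) < d ^+ 2 -> `|u x - L| <= e.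
Proof.
move=> n2 K0 p1 uC2 uF d00 uE ub e e0.
have oB := @hyp_space_open R n.
have [d1 d10 H1] : exists2 d : R, 0 < d & forall x, hyp_space R n x ->
    eucl_sqnorm (x - p) < d ^+ 2 -> u x <= L + e.
  apply: (limsup_at_puncture n2 K0 p1 uC2 _ d00 uE _ e0).
    by move=> x /uF; rewrite ler_norml lerNl => /andP[].
  move=> e' /ub[d dp Hd]; exists d => // y y1 /(Hd _ y1).
  by rewrite ler_norml => /andP[_]; clear; lra.
have [d2 d20 H2] : exists2 d : R, 0 < d & forall x, hyp_space R n x ->
    eucl_sqnorm (x - p) < d ^+ 2 -> - u x <= - L + e.
  apply: (limsup_at_puncture n2 K0 p1 (Ck_opp oB uC2) _ d00 _ _ e0).
  - move=> x hx; rewrite mean_curvature_opp // opprK.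
    by have := uF x hx; rewrite ler_norml => /andP[].
  - move=> y; apply: (@continuous_comp _ _ _ (u : subspace (punctured p d0) -> R) -%R); first exact: uE.
    exact: opp_continuous.
  - move=> e' /ub[d dp Hd]; exists d => // y y1 /(Hd _ y1).
    by rewrite ler_norml => /andP[+ _]; clear; lra.
exists (Num.min d1 d2); first by rewrite lt_min d10.
have sq (a b : R) : 0 < a -> a <= b -> a ^+ 2 <= b ^+ 2.
  by move=> a0 ab; rewrite lerXn2r ?nnegrE ?(ltW a0) // (le_trans (ltW a0)).
have m0 : 0 < Num.min d1 d2 by rewrite lt_min d10.
have [m1 m2] : Num.min d1 d2 <= d1 /\ Num.min d1 d2 <= d2 by rewrite !ge_min !lexx orbT.
move=> x hx xm.
have u1 := H1 x hx (lt_le_trans xm (sq _ _ m0 m1)).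
have u2 := H2 x hx (lt_le_trans xm (sq _ _ m0 m2)).
by rewrite ler_norml; apply/andP; split; clear - u1 u2; lra.
Qed.

(** * Removability of the punctures *)

Unset Implicit Arguments.
Theorem theorem1p3 (R : realType) (n : nat) (n_ge2 : (2 <= n)%N)
    (f : 'rV[R]_n -> R -> R)
    (f_C1 : Ck 1 [set z : 'rV[R]_n * R | hyp_space R n z.1]
               (fun z : 'rV[R]_n * R => f z.1 z.2))
    (f_t_le0 : forall x t, hyp_space R n x -> derive1 (f x) t <= 0)
    (* condition (I) *)
    (o : 'rV[R]_n) (o_in : hyp_space R n o)
    (phi : R -> R)
    (phi_cont : {within `[0, +oo[, continuous phi})
    (phi_decr : forall r s, 0 <= r -> r <= s -> phi s <= phi r)
    (f_le_phi : forall x t, hyp_space R n x -> `|f x t| <= phi (hyp_dist x o))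
    (phi_int : (\int[lebesgue_measure]_(r in `[0%R, +oo[)
                  (Num.sqrt (phi r))%:E < +oo)%E)
    (* condition (II) *)
    (h : R -> R) (h_cont : continuous h)
    (h_pinfty : h t @[t --> +oo] --> (0 : R))
    (h_ninfty : h t @[t --> -oo] --> (0 : R))
    (f_le_h : forall x t, hyp_space R n x -> `|f x t| <= h t)
    (* boundary data *)
    (k : nat) (p : 'I_k -> 'rV[R]_n) (p_bnd : forall i, hyp_boundary R n (p i))
    (varphi : 'rV[R]_n -> R)
    (varphi_cont : {within hyp_boundary R n, continuous varphi})
    (* the solution *)
    (u : 'rV[R]_n -> R)
    (u_C2 : Ck 2 (hyp_space R n) u)
    (u_C0 : {within hyp_closure R n `\` range p, continuous u})
    (u_eq : forall x, hyp_space R n x -> - hyp_mean_curvature u x = f x (u x))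
    (u_bnd : forall x, (hyp_boundary R n `\` range p) x -> u x = varphi x) :
  exists v : 'rV[R]_n -> R,
    {within hyp_closure R n, continuous v} /\
    (forall x, (hyp_closure R n `\` range p) x -> v x = u x).
Proof.
have [K K0 HK] := decay_of_radial_bound o_in phi_cont phi_decr phi_int.
have mcK x : hyp_space R n x -> `|hyp_mean_curvature u x| <= decay K x.
  move=> hx; rewrite -normrN u_eq //.
  exact: le_trans (f_le_phi x (u x) hx) (HK x hx).
have p1 i : eucl_sqnorm (p i) = 1 by exact: p_bnd.
have cont_sqn x e : 0 < e -> exists2 d : R, 0 < d & forall y : 'rV[R]_n,
    `|y - x| < d -> eucl_sqnorm (y - x) < e ^+ 2.
  move=> e0; have e2 : 0 < e ^+ 2 / 2 by rewrite divr_gt0 // exprn_gt0.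
  have [d d0 Hd] := continuous_at_dist (sqnB_continuous (p := x) (y := x)) e2.
  exists d => // y /Hd; rewrite subrr sqn0 subr0.
  by rewrite ler_norml => /andP[_]; clear - e2; lra.
have iso x := finite_isolated p x.
(* Around one puncture, a ball free of the other ones. *)
have lim_p i e : 0 < e -> exists2 d : R, 0 < d & forall x,
    (hyp_closure R n `\` range p) x -> `|x - p i| < d -> `|u x - varphi (p i)| <= e.
  move=> e0; have [d1 d10 H1] := iso (p i).
  pose d0 : R := d1 / 2.
  have d00 : 0 < d0 by rewrite divr_gt0.
  have d01 : d0 < d1 by rewrite /d0; clear - d10; lra.
  have sub : punctured (p i) d0 `<=` hyp_closure R n `\` range p.
    move=> y [y1 /andP[yp yd]]; split.
      by move: y1; rewrite le_eqVlt => /orP[/eqP|]; [right|left].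
    move=> [j _ jy]; rewrite -jy in yp yd.
    have ji : p j != p i.
      by apply: contraTneq yp => ->; rewrite subrr sqn0 ltxx.
    have := H1 j ji; rewrite leNgt => /negP; apply; apply: norm_lt_sqn => //.
    by apply: le_lt_trans yd _; rewrite ltrXn2r ?ltW.
  have uE := continuous_subspaceW sub u_C0.
  have ub e' : 0 < e' -> exists2 d : R, 0 < d & forall y, eucl_sqnorm y = 1 ->
      0 < eucl_sqnorm (y - p i) < d ^+ 2 -> `|u y - varphi (p i)| <= e'.
    move=> e'0; have [d dp Hd] := within_continuous_dist varphi_cont (p1 i) e'0.
    exists (Num.min d d0); first by rewrite lt_min dp.
    have m0 : 0 < Num.min d d0 by rewrite lt_min dp.
    move=> y y1 /andP[yp yd].
    have ymin := norm_lt_sqn m0 yd.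
    rewrite u_bnd; last first.
      split; first exact: y1.
      apply: (sub y _).2; split; first by rewrite y1.
      rewrite yp /= (le_trans (ltW yd)) // lerXn2r ?nnegrE ?(ltW m0) ?(ltW d00) //.
      by rewrite ge_min lexx orbT.
    by apply: Hd => //; apply: lt_le_trans ymin _; rewrite ge_min lexx.
  have [d dp Hd] := limit_at_puncture n_ge2 K0 (p1 i) u_C2 mcK d00 uE ub e0.
  have [d' d'p Hd'] := ub e e0.
  have [r r0 Hr] := cont_sqn (p i) d dp.
  have [r' r'0 Hr'] := cont_sqn (p i) d' d'p.
  exists (Num.min r r'); first by rewrite lt_min r0.
  move=> x [[hx|bx] nx]; rewrite lt_min => /andP[/Hr xd /Hr' xd']; first exact: Hd.
  apply: Hd' => //; rewrite xd' andbT lt0r sqn_ge0 andbT; apply/eqP => /sqn_eq0 /eqP.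
  by rewrite subr_eq0 => /eqP xp; apply: nx; exists i.
(* At a puncture the boundary datum is the limit. *)
pose v (x : 'rV[R]_n) : R := if pselect (range p x) then varphi x else u x.
have vN x : ~ range p x -> v x = u x by move=> nx; rewrite /v; case: pselect.
have vp i : v (p i) = varphi (p i).
  by rewrite /v; case: pselect => // H; exfalso; apply: H; exists i.
exists v; split; last by move=> x [_ nx]; exact: vN.
apply: continuous_within_of_dist => y cy e e0.
have [d1 d10 H1] := iso y.
have near_p i : `|p i - y| < d1 -> p i = y.
  by move=> pd; apply/eqP; apply: contraTT pd => /H1; rewrite -leNgt.
have [[i _ iy]|ny] := pselect (range p y).
  have [d dp Hd] := lim_p i e e0.
  exists (Num.min d1 d); first by rewrite lt_min d10.
  move=> x cx; rewrite lt_min => /andP[xd1 xd].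
  have [[j _ jx]|nx] := pselect (range p x).
    rewrite -jx in xd1 *; rewrite (near_p j xd1) subrr normr0; exact: ltW.
  by rewrite -{1}iy vp vN //; apply: Hd => //; rewrite iy.
have [d dp Hd] := within_continuous_dist u_C0 (conj cy ny) e0.
exists (Num.min d1 d); first by rewrite lt_min d10.
move=> x cx; rewrite lt_min => /andP[xd1 xd].
have nx : ~ range p x.
  by move=> [j _ jx]; apply: ny; rewrite -jx in xd1; rewrite -(near_p j xd1); exists j.
by rewrite !vN //; apply: Hd.
Qed.
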